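(* Let $n$ be an integer greater than $11$. If $\vartheta(C_n,3)\leq 1$, then $\delta(C_n)\geq\delta(A_{n-4})+7$.
   Context: Polygons are treated combinatorially: a convex polygon is a finite set of vertices with a clockwise cyclic order; edges are $2$-element vertex sets, two edges cross if disjoint with alternating vertices in the cyclic order; a triangulation is an inclusion-maximal set of pairwise non-crossing edges; for an interior edge $\varepsilon$ of $T$, $T/\varepsilon$ is obtained by replacing $\varepsilon$ by the other diagonal of the unique quadrilateral with diagonal $\varepsilon$ and sides in $T$ (a flip). For a pair $P=\{U,V\}$, $\delta(P)$ is the minimum number of flips transforming $U$ into $V$; a path realizing it is geodesic. For a vertex $a$ with clockwise successor $b$ and a triangulation $T$, $\mathrm{lk}_T(\{a,b\})$ is the unique vertex $x$ with $\{a,x\},\{b,x\}\in T$; a flip $T\to T'$ is incident to $\{a,b\}$ if the links differ; $\vartheta(P,a)$ is the maximum over geodesic paths between $U$ and $V$ of the number of flips incident to $\{a,b\}$. Deletion: for a vertex $a$ of a polygon with at least $4$ vertices, with clockwise successor $b$, $T\ominus a=\{\varepsilon \text{ with } a \text{ replaced by } b:\varepsilon\in T\setminus\{\{a,b\}\}\}$. Zigzag: for $N\geq 4$, on the polygon with vertices $0,\dots,N-1$ labeled clockwise (mod $N$), $Z_N$ is the triangulation whose interior edges are $\varepsilon_{2k+1}=\{2-k,4+k\}$ and $\varepsilon_{2k+2}=\{1-k,4+k\}$ ($k\geq0$), for indices $1,\dots,N-3$. In a polygon with $N$ vertices, $\bar k=k+\lfloor N/2\rfloor$. Pair $A_n$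 ($n\geq3$): $A_n^-$ is $Z_{n+4}$ with $0,1,\bar0,\bar1$ deleted successively ($\bar k=k+\lfloor (n+4)/2\rfloor$), remaining vertices relabeled clockwise $0,\dots,n-1$ with vertex $2$ keeping label $2$; $A_n^+$ is $Z_{n+4}$ with $4,5,\bar4,\bar5$ deleted successively, relabeled clockwise $0,\dots,n-1$ with former vertex $2$ getting label $1$. Both are triangulations of the polygon with vertices $0,\dots,n-1$; $A_n=\{A_n^-,A_n^+\}$. Pair $C_n$ ($n\geq 7$): let $T=A_{n+1}^-/\{2,5\}/\{2,4\}/\{2,6\}$ (flipped in this order; the last flip introduces $\{1,3\}$, also an edge of $A_{n+1}^+$). With $E=\{\{1,2\},\{2,3\}\}$, $B_n^-=T\setminus E$ and $B_n^+=A_{n+1}^+\setminus E$ are triangulations of the polygon with vertex $2$ removed, whose vertices are relabeled clockwise $0,\dots,n-1$ so that vertex $3$ keeps its label (old $n\mapsto0$, $0\mapsto1$, $1\mapsto2$, $k\mapsto k$ for $3\leq k\leq n-1$). $C_n^-=B_n^-/\{4,6\}$ and $C_n=\{C_n^-,B_n^+\}$. *)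

(* Defs.v *)
From mathcomp Require Import all_boot finmap.
From mathcomp Require Import boolp.

Set Implicit Arguments.
Unset Strict Implicit.
Unset Printing Implicit Defensive.

Local Open Scope fset_scope.
Local Open Scope nat_scope.

(* A convex polygon is a finite set [V] of natural numbers, its vertices, in
   the clockwise cyclic order induced by the usual order of the naturals. *)

Notation edge_set := {fset {fset nat}}.

Definition clockwise (a b c : nat) : bool :=
  [|| a < b < c, b < c < a | c < a < b].

Definition clockwise_seq (V : {fset nat}) : seq nat := sort leq V.

Definition successor (V : {fset nat}) (a : nat) : nat :=
  next (clockwise_seq V) a.

Definition edges (V : {fset nat}) : edge_set :=
  [fset e in fpowerset V | #|` e| == 2].

Definition boundary (V : {fset nat}) : edge_set :=
  [fset [fset a; successor V a] | a in V].

Definition cross (e f : {fset nat}) : bool :=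
  fdisjoint e f &&
  [exists a : e, exists b : e, exists c : f, exists d : f,
    clockwise (val a) (val c) (val b) && clockwise (val b) (val d) (val a)].

Definition noncrossing (V : {fset nat}) (T : edge_set) : Prop :=
  T `<=` edges V /\ {in T &, forall e f, ~~ cross e f}.

Definition triangulation (V : {fset nat}) (T : edge_set) : Prop :=
  noncrossing V T /\ forall T', noncrossing V T' -> T `<=` T' -> T' = T.

(* The edges [f] that are, together with [e], the two diagonals of a
   quadrilateral with sides in [T]. If [T] is a triangulation and [e] is one
   of its interior edges, there is exactly one such [f]. *)
Definition opposite_diagonals (V : {fset nat}) (T : edge_set)
    (e : {fset nat}) : edge_set :=
  [fset f in edges V | cross e f &&
    [forall x : e, forall y : f, [fset val x; val y] \in T]].

Definition flip (V : {fset nat}) (T : edge_set) (e : {fset nat}) :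
    edge_set :=
  (T `\ e) `|` opposite_diagonals V T e.

Definition flip_step (V : {fset nat}) : rel edge_set :=
  fun T T' => `[< triangulation V T /\
    exists e, [/\ e \in T, e \notin boundary V & T' = flip V T e] >].

(* [s] lists the triangulations visited after [P.1], so the path consists of
   [size s] flips. *)
Definition flip_path (V : {fset nat})
    (P : edge_set * edge_set) (s : seq edge_set) :
    bool :=
  path (flip_step V) P.1 s && (last P.1 s == P.2).

Definition joined_by (V : {fset nat})
    (P : edge_set * edge_set) (m : nat) : bool :=
  `[< exists s, flip_path V P s /\ size s = m >].

(* The value 0 in the absence of a path is a dummy: the flip graph of a
   polygon is connected. *)
Definition delta (V : {fset nat})
    (P : edge_set * edge_set) : nat :=
  if pselect (exists m, joined_by V P m) is left h then ex_minn h else 0.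

Definition geodesic (V : {fset nat})
    (P : edge_set * edge_set) (s : seq edge_set) :
    Prop :=
  flip_path V P s /\ size s = delta V P.

(* For a boundary edge {a, b} of a triangulation [T] this is a singleton,
   consisting of the apex of the triangle of [T] on {a, b}. *)
Definition lk (V : {fset nat}) (T : edge_set) (a b : nat) :
    {fset nat} :=
  [fset x in V | ([fset a; x] \in T) && ([fset b; x] \in T)].

Definition incident (V : {fset nat}) (a : nat) (T T' : edge_set) :
    bool :=
  lk V T a (successor V a) != lk V T' a (successor V a).

Definition incident_flips (V : {fset nat}) (a : nat)
    (U : edge_set) (s : seq edge_set) : nat :=
  sumn (pairmap (fun T T' => incident V a T T' : nat) U s).

(* The range of [k] is no restriction: a geodesic has [delta V P] flips. *)
Definition vartheta (V : {fset nat})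
    (P : edge_set * edge_set) (a : nat) : nat :=
  \max_(k < (delta V P).+1 |
        `[< exists s, geodesic V P s /\ incident_flips V a P.1 s = k >]) k.

Definition deletion (VT : {fset nat} * edge_set) (a : nat) :
    {fset nat} * edge_set :=
  let: (V, T) := VT in
  let b := successor V a in
  (V `\ a,
   [fset [fset (if x == a then b else x) | x in (e : {fset nat})] |
     e in T `\ [fset a; b]]).

(* The vertices are numbered clockwise modulo their number, starting with the
   label [l] at the vertex [a]. *)
Definition new_label (V : {fset nat}) (a l x : nat) : nat :=
  let s := clockwise_seq V in
  (l + index x (rot (index a s) s)) %% size s.

Definition relabel (VT : {fset nat} * edge_set) (a l : nat) :
    edge_set :=
  [fset [fset new_label VT.1 a l x | x in (e : {fset nat})] | e in VT.2].

Definition polygon (n : nat) : {fset nat} := [fset x in iota 0 n].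

(* With i = 2k this is {2 - k, 4 + k}, with i = 2k + 1 it is {1 - k, 4 + k};
   thus it is the zigzag edge of index i + 1, for i < N - 3. *)
Definition zigzag_edge (N i : nat) : {fset nat} :=
  [fset (N + (if odd i then 1 else 2) - i./2) %% N; (4 + i./2) %% N].

Definition zigzag (N : nat) : edge_set :=
  boundary (polygon N) `|` [fset zigzag_edge N i | i in iota 0 (N - 3)].

Definition bar (N k : nat) : nat := (k + N./2) %% N.

Definition A_minus (n : nat) : edge_set :=
  let N := n + 4 in
  relabel (foldl deletion (polygon N, zigzag N) [:: 0; 1; bar N 0; bar N 1])
    2 2.

Definition A_plus (n : nat) : edge_set :=
  let N := n + 4 in
  relabel (foldl deletion (polygon N, zigzag N) [:: 4; 5; bar N 4; bar N 5])
    2 1.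

Definition pair_A (n : nat) : edge_set * edge_set :=
  (A_minus n, A_plus n).

Definition ear2 : edge_set := [fset [fset 1; 2]; [fset 2; 3]].

Definition B_minus (n : nat) : edge_set :=
  let V := polygon n.+1 in
  let T := foldl (flip V) (A_minus n.+1)
             [:: [fset 2; 5]; [fset 2; 4]; [fset 2; 6]] in
  relabel (V `\ 2, T `\` ear2) 3 3.

Definition B_plus (n : nat) : edge_set :=
  relabel (polygon n.+1 `\ 2, A_plus n.+1 `\` ear2) 3 3.

Definition C_minus (n : nat) : edge_set :=
  flip (polygon n) (B_minus n) [fset 4; 6].

Definition pair_C (n : nat) : edge_set * edge_set :=
  (C_minus n, B_plus n).

(* Main.v *)
Require Import Defs.
From mathcomp Require Import all_boot finmap.
From mathcomp Require Import boolp zify.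

(** Identifying the vertices 0, 1, 2, 3 of the [n]-gon with each other, and 4
    with 5, sends every triangulation to a triangulation of the [(n - 4)]-gon
    and every flip to a flip, except that the flips in a quadrilateral two
    consecutive corners of which are identified disappear. Up to a reflection,
    it turns the pair [C_n] into [A_(n-4)], with the two triangulations
    exchanged. So it suffices to find seven flips that disappear on a geodesic
    between the triangulations of [C_n] with at most one flip incident to the
    side {3, 4}; such a geodesic exists by hypothesis.

    - The number of diagonals among {0, 2}, {0, 3}, {1, 3} grows from 0 to 2,
      which takes two flips in quadrilaterals with three corners in
      {0, 1, 2, 3}.
    - Each of the vertices 6, 7, 8 is the apex of a triangle on two vertices of
      {0, 1, 2, 3} at the beginning and none is at the end, which takes three
      flips in quadrilaterals with exactly two corners in {0, 1, 2, 3}, none of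
      which has the side {4, 5}.
    - The apex over {4, 5} moves from 3 to [n - 2]. A single flip could only do
      this in the quadrilateral 3, 4, 5, [n - 2]; it would move the apex over
      {3, 4} to [n - 2], and since this apex is [n - 1] at the end, a second
      flip incident to {3, 4} would follow. So two flips are incident to
      {4, 5}. *)

Set Implicit Arguments.
Unset Strict Implicit.
Unset Printing Implicit Defensive.

Local Open Scope fset_scope.
Local Open Scope nat_scope.

Local Ltac lia_if := repeat match goal with
  | |- context [if ?b then _ else _] =>
    lazymatch b with
    | context [if _ then _ else _] => fail
    | _ => case: (boolP b) => ? /=
    end
  end; lia.

(** * Edges, crossings and flips *)

Definition adj (T : edge_set) (x y : nat) : bool := [fset x; y] \in T.

Lemma adj_sym T x y : adj T x y = adj T y x.
Proof. by rewrite /adj fsetUC. Qed.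

Lemma eq_fset2 (x y u v : nat) :
  ([fset x; y] == [fset u; v]) =
  ((x == u) && (y == v)) || ((x == v) && (y == u)).
Proof.
apply/eqP/idP=> [/fsetP h|].
  move: (h x) (h y) (h u) (h v); rewrite !in_fset2 !eqxx ?orbT /=.
  by do 4! move/esym; do !case: eqP => //=; lia.
by case/orP=> /andP[/eqP-> /eqP->] //; rewrite fsetUC.
Qed.

Lemma adj_edges V x y : adj (edges V) x y = [&& x \in V, y \in V & x != y].
Proof.
rewrite /adj !inE /= fpowersetE cardfs2 eqSS andbA; congr (_ && _).
  by rewrite fsubUset !fsub1set.
by case: (x != y).
Qed.

Lemma edgesP V e : reflect
  (exists x y, [/\ x \in V, y \in V, x != y & e = [fset x; y]])
  (e \in edges V).
Proof.
apply: (iffP idP) => [|[x [y [xV yV xy ->]]]]; last first.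
  by move: (adj_edges V x y); rewrite /adj xV yV xy.
move=> h; have: #|` e| == 2 by move: h; rewrite !inE /= => /andP[].
move=> /eqP e2; have /fset0Pn[x xe] : e != fset0 by rewrite -cardfs_gt0 e2.
have : #|` e `\ x| == 1 by have := cardfsD1 x e; rewrite xe e2; lia.
case/cardfs1P => y ey; have eE : e = [fset x; y] by rewrite -ey fsetD1K.
by exists x, y; move: h; rewrite eE -/(adj _ x y) adj_edges => /and3P[].
Qed.


Lemma cross2 a b c d : a < c -> b < d ->
  cross [fset a; c] [fset b; d] = (a < b < c) && (c < d) || (b < a < d) && (d < c).
Proof.
move=> ac bd; apply/idP/idP.
  case/andP=> _ /existsP[[x xe]] /existsP[[y ye]] /existsP[[z ze]].
  case/existsP=> [[t te]] /=; move: xe ye ze te; rewrite !in_fset2.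
  do 4! (case/orP=> /eqP ->); rewrite /clockwise; lia.
move=> h; apply/andP; split.
  by apply/fdisjointP => x; rewrite !in_fset2; lia.
have [ha hc] := (fset21 a c, fset22 a c).
have [hb hd] := (fset21 b d, fset22 b d).
(* Each of the two arcs between [a] and [c] contains one end of the second edge; which end lies on
   which arc depends on the interleaving. *)
apply/existsP; exists [` ha]; apply/existsP; exists [` hc].
case/orP: h => h.
  apply/existsP; exists [` hb]; apply/existsP; exists [` hd].
  by rewrite /= /clockwise; lia.
apply/existsP; exists [` hd]; apply/existsP; exists [` hb].
by rewrite /= /clockwise; lia.
Qed.

Lemma edges_ltP V e : e \in edges V ->
  exists x y, [/\ x \in V, y \in V, x < y & e = [fset x; y]].
Proof.
case/edgesP=> x [y [xV yV xy ->]]; case: (ltngtP x y) xy => // xy _.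
  by exists x, y.
by exists y, x; rewrite fsetUC.
Qed.

Lemma adj_subset V T T' : T `<=` edges V ->
  (forall x y, x < y -> adj T x y -> adj T' x y) -> T `<=` T'.
Proof.
move=> TV h; apply/fsubsetP => e eT.
have [x [y [_ _ xy eE]]] := edges_ltP (fsubsetP TV _ eT).
by rewrite eE; apply: h; rewrite /adj -?eE.
Qed.

Lemma adj_ext V V' T T' : T `<=` edges V -> T' `<=` edges V' ->
  (forall x y, adj T x y = adj T' x y) -> T = T'.
Proof.
move=> TV TV' h; apply/eqP; rewrite eqEfsubset.
by rewrite (adj_subset TV) ?(adj_subset TV') // => x y _; rewrite h.
Qed.

(** Excluding one interleaving of four labels is enough: the other one is the same condition with
    the two edges exchanged. *)
Definition planar (T : edge_set) : Prop :=
  forall a b c d, a < b < c -> c < d -> adj T a c -> ~~ adj T b d.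

Lemma noncrossingP V T : noncrossing V T <-> T `<=` edges V /\ planar T.
Proof.
split=> [[TV h]|[TV h]]; split=> //.
  move=> a b c d abc cd ac; apply/negP => bd.
  by have := h _ _ ac bd; rewrite cross2; lia.
move=> e f eT fT; have [a [c [_ _ ac eE]]] := edges_ltP (fsubsetP TV _ eT).
have [b [d [_ _ bd fE]]] := edges_ltP (fsubsetP TV _ fT).
have ac' : adj T a c by rewrite /adj -eE.
have bd' : adj T b d by rewrite /adj -fE.
rewrite eE fE cross2 //; apply/norP; split; apply/negP => /andP[h1 h2].
  by have := h _ _ _ _ h1 h2 ac'; rewrite bd'.
by have := h _ _ _ _ h1 h2 bd'; rewrite ac'.
Qed.

(** Maximality becomes a local condition: an edge crossed by nothing in [T] could be added to [T],
    so every missing edge must be crossed. *)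
Lemma triangulationP V T : triangulation V T <->
  [/\ T `<=` edges V, planar T
    & forall x y, x \in V -> y \in V -> x < y -> ~~ adj T x y ->
      exists u v, adj T u v /\ ((x < u < y) && (y < v) || (u < x < v) && (v < y))].
Proof.
split=> [[/noncrossingP[TV nc] mx]|[TV nc sat]].
  split=> // x y xV yV xy nxy; apply: contrapT => none.
  suff /mx E : noncrossing V ([fset x; y] |` T).
    by move: nxy; rewrite -(E (fsubsetU1 _ _)) /adj fset1U1.
  apply/noncrossingP; split.
    rewrite fsubUset TV andbT fsub1set -/(adj _ x y) adj_edges xV yV /=; lia.
  have none' u v : adj T u v ->
      ~~ ((x < u < y) && (y < v) || (u < x < v) && (v < y)).
    by move=> uv; apply/negP => a; apply: none; exists u, v.
  move=> a b c d abc cd; rewrite /adj !in_fset1U !eq_fset2 -!/(adj _ _ _) => ac.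
  apply/negP; case/orP: ac => ac; case/orP=> bd.
  - lia.
  - by have := none' _ _ bd; lia.
  - by have := none' _ _ ac; lia.
  - by have := nc _ _ _ _ abc cd ac; rewrite bd.
split; first exact/noncrossingP.
move=> T' /noncrossingP[TV' nc'] sub; apply/eqP; rewrite eqEfsubset sub andbT.
apply: (adj_subset TV') => x y xlty xy; apply: contraT => nxy.
have := fsubsetP TV' _ xy; rewrite -/(adj _ x y) adj_edges => /and3P[xV yV _].
have [u [v [uv]]] := sat _ _ xV yV xlty nxy.
have uv' : adj T' u v := fsubsetP sub _ uv.
case/orP=> /andP[h1 h2].
  by have := nc' _ _ _ _ h1 h2 xy; rewrite uv'.
by have := nc' _ _ _ _ h1 h2 uv'; rewrite xy.
Qed.

Section Triangulation.
Variables (V : {fset nat}) (T : edge_set).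
Hypothesis triT : triangulation V T.

Lemma tri_sub : T `<=` edges V.
Proof. by case/triangulationP: triT. Qed.

Lemma tri_planar a b c d : adj T a c -> adj T b d -> a < b < c -> c < d -> False.
Proof.
case/triangulationP: triT => _ h _ ac bd abc cd.
by have := h _ _ _ _ abc cd ac; rewrite bd.
Qed.

Lemma tri_sat x y : x \in V -> y \in V -> x < y -> ~~ adj T x y ->
  exists u v, adj T u v /\ ((x < u < y) && (y < v) || (u < x < v) && (v < y)).
Proof. by case/triangulationP: triT => _ _; apply. Qed.

Lemma tri_adj x y : adj T x y -> [&& x \in V, y \in V & x != y].
Proof. by move/(fsubsetP tri_sub); rewrite -/(adj _ x y) adj_edges. Qed.

Lemma tri_max T' : triangulation V T' -> T `<=` T' -> T = T'.
Proof. by case: triT => _ mx [nc _] /(mx _ nc). Qed.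

End Triangulation.

Definition exchange (T : edge_set) (a c b d : nat) : edge_set :=
  [fset b; d] |` (T `\ [fset a; c]).

Lemma adj_exchange T a c b d x y : adj (exchange T a c b d) x y =
  (((x == b) && (y == d)) || ((x == d) && (y == b))) ||
  (~~ (((x == a) && (y == c)) || ((x == c) && (y == a))) && adj T x y).
Proof. by rewrite /adj in_fset1U in_fsetD1 !eq_fset2. Qed.

Definition quad (T : edge_set) (a b c d : nat) : bool :=
  [&& a < b < c, c < d, adj T a b, adj T b c, adj T c d & adj T a d].

(** Both directions of the exchange are allowed, so that the relation is symmetric on triangulations
    and one argument treats a flip and its inverse. *)
Definition quad_flip (T T' : edge_set) (a b c d : nat) : bool :=
  quad T a b c d &&
  (adj T a c && (T' == exchange T a c b d) ||
   adj T b d && (T' == exchange T b d a c)).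

Lemma quad_flip_vertices V T T' a b c d : triangulation V T ->
  quad_flip T T' a b c d -> [&& a \in V, b \in V, c \in V & d \in V].
Proof.
move=> tri /andP[/and5P[_ _ ab bc /andP[cd _]] _].
have /and3P[-> -> _] := tri_adj tri ab.
by have /and3P[-> -> _] := tri_adj tri cd.
Qed.

(** An edge crossing one diagonal of a quadrilateral is the other diagonal or crosses a side. This
    yields both planarity and maximality after the exchange. *)
Lemma quad_flip_tri V T T' a b c d : triangulation V T ->
  quad_flip T T' a b c d -> triangulation V T'.
Proof.
move=> tri qf; have /and4P[aV bV cV dV] := quad_flip_vertices tri qf.
case/andP: qf => /and5P[abc cltd ab bc /andP[cd ad]] qf.
have nc := tri_planar tri.
(* The two directions are treated together: [p], [q] are the ends of the removed diagonal, [p'],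
   [q'] those of the new one. *)
have sides p q p' q' : p < q -> (p' < q') -> (p \in V) -> q \in V ->
    (p == a) && (q == c) && (p' == b) && (q' == d) ||
    (p == b) && (q == d) && (p' == a) && (q' == c) ->
    adj T p q -> triangulation V (exchange T p q p' q'); last first.
  by case/orP: qf => /andP[h /eqP->]; apply: sides => //; rewrite ?eqxx ?orbT //; lia.
move=> pq pq' pV qV choice hpq.
have [pV' qV'] : p' \in V /\ q' \in V.
  by case/orP: choice => /andP[/andP[_ /eqP->] /eqP->].
have hnew : adj (exchange T p q p' q') p' q' by rewrite adj_exchange !eqxx.
have hold x y : x < y -> adj T x y -> ~~ ((x == p) && (y == q)) ->
    adj (exchange T p q p' q') x y.
  by move=> xy h n0; rewrite adj_exchange h; clear -xy pq n0; lia.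
have sub : exchange T p q p' q' `<=` edges V.
  rewrite fsubUset fsub1set -/(adj _ p' q') adj_edges pV' qV' /=.
  by rewrite (fsubset_trans (fsubD1set _ _) (tri_sub tri)) andbT; clear -pq'; lia.
apply/triangulationP; split=> //.
  have key x y : x < y -> adj T x y -> ~~ ((x == p) && (y == q)) ->
      ~~ ((x < p' < y) && (y < q') || (p' < x < q') && (q' < y)).
    move=> xy h.
    have := nc _ _ _ _ h ab; have := nc _ _ _ _ h bc; have := nc _ _ _ _ h cd.
    have := nc _ _ _ _ h ad; have := nc _ _ _ _ ab h; have := nc _ _ _ _ bc h.
    have := nc _ _ _ _ cd h; have := nc _ _ _ _ ad h.
    by clear -xy choice abc cltd; case/orP: choice => /andP[/andP[/andP[/eqP-> /eqP->] /eqP->] /eqP->]; lia.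
  move=> x u y v xuy yv; rewrite !adj_exchange => xy; apply/negP => uv.
  case/orP: xy => [xy|/andP[nxy xy]]; case/orP: uv => [uv|/andP[nuv uv]].
  - by clear -xuy yv xy uv pq'; lia.
  - by have := key u v; rewrite uv; clear -xuy yv xy nuv pq'; lia.
  - by have := key x y; rewrite xy; clear -xuy yv uv nxy pq'; lia.
  - exact: nc xy uv xuy yv.
move=> x y xV yV xy nxy.
have [xpq|xpq] := boolP ((x == p) && (y == q)).
  by exists p', q'; split=> //; clear -xpq choice abc cltd; lia.
have nxy' : ~~ adj T x y by apply: contra nxy => h; apply: hold.
have nxp' : ~~ ((x == p') && (y == q')).
  by apply: contra nxy => /andP[/eqP-> /eqP->].
have [u [v [uv xuyv]]] := tri_sat tri xV yV xy nxy'.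
(* Only the removed diagonal can fail as a witness; in that case a side of the quadrilateral, which
   is kept, crosses [xy] as well. *)
have [upq|upq] := boolP ((u == p) && (v == q)); last first.
  by exists u, v; split=> //; apply: hold => //; clear -xuyv xy; lia.
have side s t : adj T s t -> s < t -> ~~ ((s == p) && (t == q)) ->
    (x < s < y) && (y < t) || (s < x < t) && (t < y) -> exists u v,
    adj (exchange T p q p' q') u v /\
    ((x < u < y) && (y < v) || (u < x < v) && (v < y)).
  by move=> st lst nst h; exists s, t; split=> //; apply: hold.
have [h|h1] := boolP ((x < a < y) && (y < b) || (a < x < b) && (b < y)).
  by apply: (side a b) => //; clear -abc cltd choice; lia.
have [h|h2] := boolP ((x < b < y) && (y < c) || (b < x < c) && (c < y)).
  by apply: (side b c) => //; clear -abc cltd choice; lia.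
have [h|h3] := boolP ((x < c < y) && (y < d) || (c < x < d) && (d < y)).
  by apply: (side c d) => //; clear -abc cltd choice; lia.
have [h|h4] := boolP ((x < a < y) && (y < d) || (a < x < d) && (d < y)).
  by apply: (side a d) => //; clear -abc cltd choice; lia.
exfalso; clear -abc cltd choice xy h1 h2 h3 h4 upq xuyv nxp'.
case/andP: upq => /eqP ? /eqP ?; subst u v.
by move: xuyv nxp'; case/orP: choice => /andP[/andP[/andP[/eqP-> /eqP->] /eqP->] /eqP->]; lia.
Qed.

Lemma quad_flip_sym V T T' a b c d : triangulation V T ->
  quad_flip T T' a b c d -> quad_flip T' T a b c d.
Proof.
move=> tri qf; have tri' := quad_flip_tri tri qf.
have nc := tri_planar tri.
case/andP: qf => /and5P[abc cltd ab bc /andP[cd ad]] qf.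
have noboth : adj T a c -> adj T b d -> False.
  by move=> ac bd; apply: nc ac bd abc cltd.
apply/andP; split.
  rewrite /quad abc cltd /=; case/orP: qf => /andP[_ /eqP->];
  by rewrite !adj_exchange ab bc cd ad; clear -abc cltd; lia.
case/orP: qf => /andP[h /eqP->]; apply/orP; [right|left];
  rewrite adj_exchange !eqxx /= /exchange fsetU1K ?fsetD1K //;
  by rewrite in_fsetD1 negb_and; apply/orP; right; apply/negP; auto.
Qed.

(** [opposite_diagonals] has no second element: an end of such an edge is joined to both ends of the
    given diagonal, and if it were not a corner, one of these two edges would cross a side. *)
Lemma flip_quad V T a b c d : triangulation V T -> quad T a b c d ->
  (adj T a c -> flip V T [fset a; c] = exchange T a c b d) /\
  (adj T b d -> flip V T [fset b; d] = exchange T b d a c).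
Proof.
move=> tri /and5P[abc cltd ab bc /andP[cd ad]].
have nc := tri_planar tri.
have [/and3P[aV bV _] /and3P[cV dV _]] := (tri_adj tri ab, tri_adj tri cd).
have key p q p' q' : p < q -> p' < q' -> p' \in V -> q' \in V ->
    (p == a) && (q == c) && (p' == b) && (q' == d) ||
    (p == b) && (q == d) && (p' == a) && (q' == c) ->
    adj T p q -> flip V T [fset p; q] = exchange T p q p' q'; last first.
  by split=> h; apply: key; rewrite ?eqxx ?orbT //; clear -abc cltd; lia.
move=> pq pq' pV' qV' choice hpq.
have crs : cross [fset p; q] [fset p'; q'].
  by rewrite cross2 //; clear -choice abc cltd; lia.
have [s1 s2] : adj T p p' /\ adj T q q'.
  by case/orP: choice => /andP[/andP[/andP[/eqP ? /eqP ?] /eqP ?] /eqP ?];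
     subst p q p' q'; split; rewrite // adj_sym.
have [s3 s4] : adj T p q' /\ adj T q p'.
  by case/orP: choice => /andP[/andP[/andP[/eqP ? /eqP ?] /eqP ?] /eqP ?];
     subst p q p' q'; split; rewrite // adj_sym.
rewrite /flip fsetUC; congr (_ `|` _); apply/fsetP => f.
rewrite !inE /= fpowersetE; apply/idP/eqP => [|->]; last first.
  rewrite crs.
  have := adj_edges V p' q'; rewrite /adj !inE /= fpowersetE pV' qV' /= => ->.
  rewrite (_ : p' != q') /=; last by clear -pq'; lia.
  apply/forallP => [[x /=]]; rewrite in_fset2 => xe.
  apply/forallP => [[y /=]]; rewrite in_fset2 => ye; rewrite -/(adj T x y).
  by case/orP: xe => /eqP->; case/orP: ye => /eqP->; rewrite // adj_sym.
case/andP => fV; have /edges_ltP[u [v [_ _ uv fE]]] : f \in edges V.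
  by rewrite !inE /= fpowersetE.
rewrite fE cross2 // => /andP[alt' /forallP h].
have h' x y : x \in [fset p; q] -> y \in [fset u; v] -> adj T x y.
  by move=> xe ye; have /forallP/(_ [` ye]) := h [` xe].
have [hpu hpv] : adj T p u /\ adj T p v by split; apply: h'; rewrite !inE eqxx ?orbT.
have [hqu hqv] : adj T q u /\ adj T q v by split; apply: h'; rewrite !inE eqxx ?orbT.
clear h h' fV fE f crs pV' qV' aV bV cV dV; apply/eqP; rewrite eq_fset2.
have ncs x y : adj T x y -> forall z t, adj T z t -> x < z < y -> y < t -> False.
  by move=> xy z t zt; apply: nc.
clear nc.
have hup : adj T u p by rewrite adj_sym.
have hvp : adj T v p by rewrite adj_sym.
have huq : adj T u q by rewrite adj_sym.
have hvq : adj T v q by rewrite adj_sym.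
case/orP: choice => /andP[/andP[/andP[/eqP ? /eqP ?] /eqP ?] /eqP ?]; subst p q p' q'.
  have := ncs _ _ ab _ _ huq; have := ncs _ _ hpu _ _ bc.
  have := ncs _ _ hpv _ _ cd; have := ncs _ _ ad _ _ hqv.
  have := ncs _ _ ab _ _ hvq; have := ncs _ _ hpv _ _ bc.
  have := ncs _ _ huq _ _ ad.
  by clear -abc cltd uv alt'; lia.
have := ncs _ _ bc _ _ huq; have := ncs _ _ hpu _ _ cd.
have := ncs _ _ ad _ _ hpv; have := ncs _ _ bc _ _ hvq.
have := ncs _ _ hpv _ _ cd; have := ncs _ _ hup _ _ ad.
have := ncs _ _ ab _ _ huq.
by clear -abc cltd uv alt'; lia.
Qed.

(** * Triangulations of the polygon with vertices 0, ..., n - 1 *)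

Lemma in_polygon n x : (x \in polygon n) = (x < n).
Proof. by rewrite !inE /= mem_iota. Qed.

Lemma clockwise_seqE V s : sorted ltn s -> s =i V -> clockwise_seq V = s.
Proof.
move=> ss sV; apply: (sorted_eq leq_trans anti_leq).
- exact/sort_sorted/leq_total.
- by apply: sub_sorted ss => x y /ltnW.
- rewrite perm_sort; apply: uniq_perm => [||x]; first exact: fset_uniq.
    exact: sorted_uniq ltn_trans ltnn _ ss.
  by rewrite sV.
Qed.

Lemma mem_clockwise_seq V : clockwise_seq V =i V.
Proof. by move=> x; rewrite mem_sort. Qed.

Lemma clockwise_seq_sorted V : sorted ltn (clockwise_seq V).
Proof.
rewrite ltn_sorted_uniq_leq; apply/andP; split; first by rewrite sort_uniq fset_uniq.
exact/sort_sorted/leq_total.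
Qed.

Lemma next_cat_cons (s1 s2 : seq nat) a b :
  uniq (s1 ++ a :: b :: s2) -> next (s1 ++ a :: b :: s2) a = b.
Proof.
move=> us; rewrite next_nth mem_cat inE eqxx orbT /=.
have as1 : a \notin s1.
  by move: us; rewrite cat_uniq => /and3P[_ /hasPn h _]; apply/h/mem_head.
case: s1 as1 {us} => [|y s1] as1; first by rewrite /= eqxx.
have ya : y != a by apply: contra as1 => /eqP->; rewrite inE eqxx.
rewrite /= (negPf ya) index_cat; case: ifP => [h|_].
  by move: as1; rewrite inE h orbT.
by rewrite /= eqxx addn0 nth_cat ltnNge leqnSn /= subSnn.
Qed.

Lemma successor_lt V a b : a \in V -> b \in V -> a < b ->
  {in V, forall c, ~~ (a < c < b)} -> successor V a = b.
Proof.
move=> aV bV ab none; rewrite /successor.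
move: (clockwise_seq_sorted V) (mem_clockwise_seq V).
have : a \in clockwise_seq V by rewrite mem_clockwise_seq.
case/splitPr=> s1 s2 ss mem.
have us := sorted_uniq ltn_trans ltnn ss.
move: ss; rewrite (sorted_pairwise ltn_trans) pairwise_cat /=.
case/and4P=> /allrelP h1 _ /allP h2 ss2.
have bs : b \in s1 ++ a :: s2 by rewrite mem.
have bs2 : b \in s2.
  move: bs; rewrite mem_cat inE => /or3P[/h1 /(_ (mem_head _ _))|/eqP|//]; lia.
case: s2 us mem h1 h2 ss2 bs bs2 => // c s2 us mem _ h2 /= /andP[/allP h3 _] _.
rewrite next_cat_cons // inE => /orP[/eqP//|/h3 cb].
have : c \in V by rewrite -mem mem_cat !inE eqxx !orbT.
by move/none; rewrite cb h2 // mem_head.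
Qed.

Lemma successor_max V a b : a \in V -> b \in V ->
  {in V, forall c, b <= c <= a} -> successor V a = b.
Proof.
move=> aV bV ext; rewrite /successor next_nth.
rewrite mem_clockwise_seq aV.
move: (clockwise_seq_sorted V) (mem_clockwise_seq V).
case: (clockwise_seq V) => [_ mem|y s ss mem]; first by move: aV; rewrite -mem.
have us := sorted_uniq ltn_trans ltnn ss.
have yV : y \in V by rewrite -mem mem_head.
have yb : y = b.
  have : b \in y :: s by rewrite mem.
  rewrite inE => /orP[/eqP//|bs].
  have := ext _ yV; move: ss => /= /(order_path_min ltn_trans)/allP/(_ _ bs); lia.
(* The last vertex has an index out of range for the tail, so [nth] returns its default value, the
   first vertex. *)
rewrite nth_default //; have : a \in y :: s by rewrite mem.
move: ss us mem; case/lastP: s => [|s z] ss us mem.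
  by [].
have zV : z \in V by rewrite -mem inE mem_rcons mem_head orbT.
move=> as_; have az : a = z.
  move: as_ ss; rewrite -rcons_cons mem_rcons inE => /orP[/eqP//|as_].
  rewrite (sorted_pairwise ltn_trans) -cats1 pairwise_cat => /and3P[/allrelP h _ _].
  by have := h _ _ as_ (mem_head _ _); have := ext _ zV; lia.
move: us; rewrite az -rcons_cons rcons_uniq => /andP[nz _].
by rewrite size_rcons -cats1 index_cat (negPf nz) /= eqxx addn0.
Qed.

Lemma successor_polygon n x : x < n ->
  successor (polygon n) x = if x.+1 < n then x.+1 else 0.
Proof.
move=> xn; case: ltnP => xn'.
  by apply: successor_lt => [||//|c _]; rewrite ?in_polygon; lia.
by apply: successor_max => [||c]; rewrite ?in_polygon; lia.
Qed.

Lemma adj_boundary n x y : x < y -> adj (boundary (polygon n)) x y =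
  (y < n) && ((y == x.+1) || (x == 0) && (y.+1 == n)).
Proof.
move=> xy; rewrite /adj; apply/imfsetP/idP => /=.
  case=> z; rewrite in_polygon => zn /eqP.
  by rewrite successor_polygon // eq_fset2; case: ltnP; lia.
case/andP=> yn /orP[/eqP yx|/andP[/eqP x0 /eqP yn']].
  by exists x; rewrite ?in_polygon ?successor_polygon -?yx ?yn //; lia.
exists y; first by rewrite in_polygon.
by rewrite successor_polygon // yn' ltnn x0 fsetUC.
Qed.

Section PolygonTriangulation.
Variables (n : nat) (T : edge_set).
Hypothesis triT : triangulation (polygon n) T.
Let nc := tri_planar triT.

Lemma tri_lt x y : adj T x y -> [&& x < n, y < n & x != y].
Proof. by move/(tri_adj triT); rewrite !in_polygon. Qed.

Lemma tri_side x : x.+1 < n -> adj T x x.+1.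
Proof.
move=> xn; apply: contraT => h.
have [||//|u [v [_]]] := tri_sat triT _ _ _ h; rewrite ?in_polygon; lia.
Qed.

Lemma tri_root : 1 < n -> adj T 0 n.-1.
Proof.
move=> n1; apply: contraT => h.
have [|||u [v [/tri_lt]]] := tri_sat triT _ _ _ h; rewrite ?in_polygon; lia.
Qed.

(** The apex is the largest neighbour of [a] strictly between [a] and [c]: an edge crossing the
    missing [bc] would cross [ab] or [ac], or start at [a] and contradict maximality. *)
Lemma apex_in a c : a.+1 < c -> adj T a c ->
  exists b, [/\ a < b < c, adj T a b & adj T b c].
Proof.
move=> ac hac; have /and3P[_ cn _] := tri_lt hac.
pose P b := (a < b < c) && adj T a b.
have exP : exists b, P b.
  by exists a.+1; rewrite /P tri_side ?andbT; lia.
have bd b : P b -> b <= c by case/andP; lia.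
case: (ex_maxnP exP bd) => b /andP[abc hab] mx; exists b; split=> //.
apply: contraT => nbc.
have [|||u [v [uv h]]] := tri_sat triT _ _ _ nbc; rewrite ?in_polygon; try lia.
exfalso; case/orP: h => h.
  by apply: (nc hac uv); lia.
have [ua|ua|ua] := ltngtP u a.
- by apply: (nc uv hac); lia.
- by apply: (nc hab uv); lia.
- have := mx v; rewrite /P -ua uv; lia.
Qed.

(** Starting from the edge between 0 and [n.-1], which encloses [ac], one passes repeatedly to the
    side of the inner triangle that still encloses [ac], until [ac] itself is a side of the
    triangle. *)
Lemma apex_out a c : a < c -> (0 < a) || (c.+1 < n) -> adj T a c ->
  exists d, [/\ (d < a) || (c < d), adj T a d & adj T c d].
Proof.
move=> ac out hac; have /and3P[_ cn _] := tri_lt hac.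
have: exists i j, [/\ i <= a, c <= j, (i != a) || (j != c) & adj T i j].
  by exists 0, n.-1; split; rewrite ?tri_root //; lia.
case=> i [j]; have [k] := ubnP (j - i); elim: k i j => // k IH i j ji [ia cj ne hij].
have ij : i.+1 < j by lia.
have [b [ibj hib hbj]] := apex_in ij hij.
have [ba|ab] := leqP b a.
  have [ba'|ba'] := boolP ((b == a) && (j == c)); last first.
    by apply: (IH b j); [lia|split=> //; lia].
  exists i; move: ba' => /andP[/eqP ba' /eqP jc]; subst b j.
  by split; rewrite 1?adj_sym //; lia.
have [cb|bc] := leqP c b.
  have [ba'|ba'] := boolP ((i == a) && (b == c)); last first.
    by apply: (IH i b); [lia|split=> //; lia].
  exists j; move: ba' => /andP[/eqP ba' /eqP jc]; subst b i.
  by split=> //; lia.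
exfalso; have [ia'|ia'] := ltnP i a; first by apply: (nc hib hac); lia.
by apply: (nc hac hbj); lia.
Qed.

End PolygonTriangulation.

(** An interior edge bounds a triangle on either side, and the two apices complete it to a
    quadrilateral. Whether the outer apex lies below or above the edge decides which diagonal it is
    once the corners are sorted. *)
Lemma flip_stepP n T T' : flip_step (polygon n) T T' <->
  triangulation (polygon n) T /\ exists a b c d, quad_flip T T' a b c d.
Proof.
split=> [/asboolP[tri [e [eT eb ->]]]|[tri [a [b [c [d qf]]]]]]; last first.
  apply/asboolP; split=> //.
  have := quad_flip_vertices tri qf; rewrite !in_polygon => /and4P[_ _ _ dn].
  case/andP: qf => q; have /and3P[abc cd _] := q.
  have [flipac flipbd] := flip_quad tri q.
  case/orP=> /andP[h /eqP->].
    exists [fset a; c]; split=> //; last by rewrite flipac.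
    by rewrite -/(adj _ a c) adj_boundary; lia.
  exists [fset b; d]; split=> //; last by rewrite flipbd.
  by rewrite -/(adj _ b d) adj_boundary; lia.
split=> //.
have [x [y [_ yn xy eE]]] := edges_ltP (fsubsetP (tri_sub tri) _ eT).
move: yn; rewrite in_polygon => yn; subst e; rewrite -/(adj T x y) in eT.
move: eb; rewrite -/(adj _ x y) adj_boundary // yn /= => eb.
have [b [xby xb by_]] : exists b, [/\ x < b < y, adj T x b & adj T b y].
  by apply: (apex_in tri) => //; lia.
have [d [dxy xd yd]] : exists d, [/\ (d < x) || (y < d), adj T x d & adj T y d].
  by apply: (apex_out tri) => //; lia.
case/orP: dxy => dxy.
  have q : quad T d x b y.
    by rewrite /quad xb by_ [adj T d x]adj_sym xd [adj T d y]adj_sym yd; lia.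
  have [_ ->//] := flip_quad tri q.
  by exists d, x, b, y; rewrite /quad_flip q eT eqxx orbT.
have q : quad T x b y d by rewrite /quad xb by_ xd yd; lia.
have [->// _] := flip_quad tri q.
by exists x, b, y, d; rewrite /quad_flip q eT eqxx.
Qed.

Lemma flip_step_tri n T T' : flip_step (polygon n) T T' ->
  triangulation (polygon n) T'.
Proof. by case/flip_stepP=> tri [a [b [c [d /(quad_flip_tri tri)]]]]. Qed.

Lemma flip_step_sym n T T' : flip_step (polygon n) T T' ->
  flip_step (polygon n) T' T.
Proof.
move=> st; apply/flip_stepP; split; first exact: flip_step_tri st.
case/flip_stepP: st => tri [a [b [c [d qf]]]].
by exists a, b, c, d; apply: quad_flip_sym tri qf.
Qed.

Lemma path_rev n T s : path (flip_step (polygon n)) T s ->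
  exists s', [/\ path (flip_step (polygon n)) (last T s) s',
                 last (last T s) s' = T & size s' = size s].
Proof.
elim/last_ind: s => [|s T' IH]; first by exists [::].
rewrite rcons_path last_rcons => /andP[/IH[s' [ps' ls' ss']] st].
exists (last T s :: s'); split=> //=; last by rewrite ss' size_rcons.
by rewrite (flip_step_sym st).
Qed.

(** * Connectedness of the flip graph, and geodesics *)

Lemma connected_to_fan n T : 2 < n -> triangulation (polygon n) T ->
  exists s, [/\ path (flip_step (polygon n)) T s,
    triangulation (polygon n) (last T s) &
    forall j, 0 < j < n -> adj (last T s) 0 j].
Proof.
move=> n2; pose deg0 T' := #|[pred j : 'I_n | adj T' 0 j]|.
have [k] := ubnP (n - deg0 T); elim: k T => // k IH T cnt tri.
have [exj|full] := pselect (exists j, (0 < j < n) && ~~ adj T 0 j); last first.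
  exists [::]; split=> // j jn; apply: contraT => nj.
  by case: full; exists j; rewrite jn.
(* With [j] the first vertex not joined to 0, the triangle beyond the edge from 0 to [j.-1] has its
   apex [d] past [j]. Flipping the edge from [j.-1] to [d] joins 0 to a new neighbour [b], so the
   degree of 0 grows. *)
case: (ex_minnP exj) => j /andP[jn nj] mn {exj}.
have j1 : 1 < j.
  by case: j jn nj {mn} => [|[|j]] //; rewrite (tri_side tri) //; lia.
have h0i : adj T 0 j.-1 by apply: contraT => h; have := mn j.-1; rewrite h; lia.
have [d [od h0d hid]] : exists d, [/\ (d < 0) || (j.-1 < d), adj T 0 d & adj T j.-1 d].
  by apply: (apex_out tri) => //; lia.
have jd : j < d.
  have : d != j by apply: contra nj => /eqP <-.
  by lia.
have [b [ibd hib hbd]] : exists b, [/\ j.-1 < b < d, adj T j.-1 b & adj T b d].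
  by apply: (apex_in tri) => //; lia.
pose T' := exchange T j.-1 d 0 b.
have qf : quad_flip T T' 0 j.-1 b d.
  by rewrite /quad_flip /quad h0i hib hbd h0d hid eqxx /= orbT andbT; lia.
have /and3P[_ dn _] := tri_lt tri h0d.
have lt : deg0 T < deg0 T'.
  apply/proper_card/properP; split.
    by apply/subsetP => x; rewrite !inE adj_exchange => ->; lia.
  have bn : b < n by lia.
  exists (Ordinal bn); rewrite !inE /=; first by rewrite adj_exchange !eqxx.
  by apply/negP => h0b; apply: (tri_planar tri h0b hid); lia.
have [||s [ps tris fans]] := IH T'.
- by have := max_card [pred j : 'I_n | adj T' 0 j]; rewrite card_ord -/(deg0 T'); lia.
- exact: quad_flip_tri tri qf.
exists (T' :: s); split=> //=; rewrite ps andbT.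
by apply/flip_stepP; split=> //; exists 0, j.-1, b, d.
Qed.

Lemma fan_unique n T T' : 2 < n ->
  triangulation (polygon n) T -> triangulation (polygon n) T' ->
  (forall j, 0 < j < n -> adj T 0 j) -> (forall j, 0 < j < n -> adj T' 0 j) ->
  T = T'.
Proof.
move=> n2 tri tri' fan fan'; apply: (tri_max tri tri').
apply: (adj_subset (tri_sub tri)) => x y xy hxy.
have /and3P[_ yn _] := tri_lt tri hxy.
have [x0|x0] := posnP x; first by rewrite x0 fan' // -x0 xy.
have [yx|yx] := ltnP x.+1 y; last first.
  by have -> : y = x.+1; [lia | apply: (tri_side tri'); lia].
have h : adj T 0 x.+1 by apply: fan; lia.
by case: (tri_planar tri h hxy); lia.
Qed.

Lemma flip_connected n T T' : 2 < n ->
  triangulation (polygon n) T -> triangulation (polygon n) T' ->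
  exists s, flip_path (polygon n) (T, T') s.
Proof.
move=> n2 tri tri'.
have [s [ps tris fans]] := connected_to_fan n2 tri.
have [s' [ps' tris' fans']] := connected_to_fan n2 tri'.
have [r [pr lr _]] := path_rev ps'.
exists (s ++ r); rewrite /flip_path /= cat_path last_cat.
by rewrite ps (fan_unique n2 tris tris' fans fans') pr lr eqxx.
Qed.

Lemma delta_min V P s : flip_path V P s -> delta V P <= size s.
Proof.
move=> ps; rewrite /delta; case: pselect => [h|//].
by case: ex_minnP => m _; apply; apply/asboolP; exists s.
Qed.

Lemma delta_geodesic V P s0 : flip_path V P s0 -> exists s, geodesic V P s.
Proof.
move=> ps; rewrite /geodesic /delta; case: pselect => [h|[]]; last first.
  by exists (size s0); apply/asboolP; exists s0.
by case: ex_minnP => m /asboolP[s sP] _; exists s.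
Qed.

Lemma incident_flips_vartheta V P a s : geodesic V P s ->
  incident_flips V a P.1 s <= vartheta V P a.
Proof.
(* The maximum in [vartheta] ranges over the numbers up to [delta V P], so the incident flips are
   first bounded by the length of the path. *)
move=> gs; have lt : incident_flips V a P.1 s < (delta V P).+1.
  rewrite -gs.2 ltnS /incident_flips; elim: s {gs} P.1 => //= T' s IH T.
  by have := IH T'; case: incident => /=; lia.
rewrite /vartheta.
by apply: (@leq_bigmax_cond _ _ _ (Ordinal lt)); apply/asboolP; exists s.
Qed.

(** * Contractions *)

(** The cardinality test drops the edges whose ends are identified. Deletions, relabellings,
    rotations and reflections are all of this form, so that a composite of them is a single
    contraction. *)
Definition contract (f : nat -> nat) (T : edge_set) : edge_set :=
  [fset e in [fset [fset f x | x in (e : {fset nat})] | e in T] | #|` e| == 2].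

Lemma imfset2 (f : nat -> nat) x y :
  [fset f z | z in [fset x; y]] = [fset f x; f y].
Proof. by rewrite imfsetU !imfset_fset1. Qed.

Lemma adj_contractP f V T u v : T `<=` edges V ->
  reflect (u != v /\ exists x y, [/\ adj T x y, f x = u & f y = v])
          (adj (contract f T) u v).
Proof.
move=> TV; apply: (iffP idP) => [|[uv [x [y [xy fx fy]]]]]; last first.
  rewrite /adj !inE /= cardfs2 uv andbT; apply/imfsetP.
  by exists [fset x; y] => //=; rewrite imfset2 fx fy.
rewrite {1}/adj !inE /= cardfs2 eqSS eqb1 => /andP[/imfsetP[e /= eT eE] uv].
split=> //; have /edgesP[x [y [_ _ _ ?]]] := fsubsetP TV _ eT; subst e.
move/eqP: eE; rewrite imfset2 eq_fset2 => /orP[] /andP[/eqP ? /eqP ?]; subst u v.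
  by exists x, y.
by exists y, x; rewrite adj_sym.
Qed.

Lemma contract_sub f V V' T : T `<=` edges V -> {in V, forall x, f x \in V'} ->
  contract f T `<=` edges V'.
Proof.
move=> TV fV; apply/fsubsetP => e; rewrite !inE /= => /andP[/imfsetP[e' /= e'T ->]].
have /edgesP[x [y [xV yV _ ->]]] := fsubsetP TV _ e'T.
by rewrite imfset2 => ->; rewrite andbT fpowersetE fsubUset !fsub1set !fV.
Qed.

Lemma contract_sub_imfset f V T : T `<=` edges V ->
  contract f T `<=` edges [fset f x | x in V].
Proof. by move=> TV; apply: contract_sub TV _ => x xV; apply: in_imfset. Qed.

Lemma contract_ext f g V T : T `<=` edges V -> {in V, f =1 g} ->
  contract f T = contract g T.
Proof.
move=> TV fg; have gf : {in V, g =1 f} by move=> x xV; rewrite fg.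
apply: (adj_ext (contract_sub_imfset f TV) (contract_sub_imfset g TV)) => u v.
have half f1 f2 : {in V, f1 =1 f2} ->
    adj (contract f1 T) u v -> adj (contract f2 T) u v.
  move=> f12 /(adj_contractP _ _ _ TV)[uv [x [y [xy fx fy]]]].
  have := fsubsetP TV _ xy; rewrite -/(adj _ x y) adj_edges => /and3P[xV yV _].
  by apply/(adj_contractP _ _ _ TV); split=> //; exists x, y; rewrite -!f12.
by apply/idP/idP; apply: half.
Qed.

Lemma contract_comp f g V T : T `<=` edges V ->
  contract f (contract g T) = contract (f \o g) T.
Proof.
move=> TV; have gV := contract_sub_imfset g TV.
apply: (adj_ext (contract_sub_imfset f gV) (contract_sub_imfset (f \o g) TV)).
move=> u v; apply/(adj_contractP _ _ _ gV)/(adj_contractP _ _ _ TV).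
  case=> uv [x [y [/(adj_contractP _ _ _ TV)[_ [x' [y' [xy <- <-]]]] fx fy]]].
  by split=> //; exists x', y'.
case=> uv [x [y [xy fx fy]]]; split=> //; exists (g x), (g y); split=> //.
apply/(adj_contractP _ _ _ TV); split; last by exists x, y.
by apply: contra uv => /eqP gxy; rewrite -fx -fy /= gxy.
Qed.

Lemma adj_contract f V T x y : T `<=` edges V -> adj T x y -> f x != f y ->
  adj (contract f T) (f x) (f y).
Proof. by move=> TV xy fxy; apply/(adj_contractP _ _ _ TV); split=> //; exists x, y. Qed.

Lemma exchange_sub V T a c b d : T `<=` edges V -> b \in V -> d \in V ->
  b != d -> exchange T a c b d `<=` edges V.
Proof.
move=> TV bV dV bd; rewrite fsubUset fsub1set -/(adj _ b d) adj_edges bV dV bd /=.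
exact: fsubset_trans (fsubD1set _ _) TV.
Qed.

(** When two consecutive corners are identified, each diagonal has the same image as a side; for
    instance [ac] and [bc] agree if [f a = f b]. So the exchange of the diagonals leaves no
    trace. *)
Lemma contract_degenerate f V T T' a b c d : triangulation V T ->
  quad_flip T T' a b c d ->
  [|| f a == f b, f b == f c, f c == f d | f a == f d] ->
  contract f T = contract f T'.
Proof.
move=> tri qf deg.
have half U U' : triangulation V U -> quad_flip U U' a b c d ->
    contract f U `<=` contract f U'; last first.
  have tri' := quad_flip_tri tri qf; have qf' := quad_flip_sym tri qf.
  by apply/eqP; rewrite eqEfsubset (half _ _ tri qf) (half _ _ tri' qf').
move=> {qf}{}tri qf; have tri' := quad_flip_tri tri qf.
have UV := tri_sub tri; have UV' := tri_sub tri'.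
have := quad_flip_sym tri qf => /andP[/and5P[_ _ ab bc /andP[cd ad]] _].
case/andP: qf => /and5P[abc cltd _ _ _] qf.
apply: (adj_subset (contract_sub_imfset f UV)) => u v _.
case/(adj_contractP _ _ _ UV)=> uv [x [y [xy fx fy]]].
have side p q : adj U' p q -> (f p = u /\ f q = v) \/ (f p = v /\ f q = u) ->
    adj (contract f U') u v.
  move=> pq [[pu qv]|[pv qu]]; apply/(adj_contractP _ _ _ UV'); split=> //.
    by exists p, q.
  by exists q, p; rewrite adj_sym.
have old : adj U' x y -> adj (contract f U') u v.
  by move=> h; apply: (side x y) => //; left.
have diag p q r s : U' = exchange U p q r s ->
    (x == p) && (y == q) || (x == q) && (y == p) \/ adj U' x y.
  move=> E; case: (boolP ((x == p) && (y == q) || (x == q) && (y == p))); first by left.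
  by move=> h; right; rewrite E adj_exchange h xy orbT.
have {}uv : u <> v by apply/eqP.
case/orP: qf => /andP[_ /eqP/diag[|/old//]] /orP[] /andP[/eqP ? /eqP ?]; subst x y u v;
  case/or4P: deg => /eqP e.
all: first [ by apply: (side a b) => //; rewrite ?e; auto
  | by apply: (side b c) => //; rewrite ?e; auto
  | by apply: (side c d) => //; rewrite ?e; auto
  | by apply: (side a d) => //; rewrite ?e; auto
  | by apply: (side a b) => //; rewrite -?e; auto
  | by apply: (side b c) => //; rewrite -?e; auto
  | by apply: (side c d) => //; rewrite -?e; auto
  | by apply: (side a d) => //; rewrite -?e; auto ].
Qed.

(** If the image of [pq] is absent afterwards, no other edge of [T] has this image, so removing [pq]
    before or after the contraction amounts to the same. *)
Lemma contract_exchange f V T p q p' q' : triangulation V T -> p' \in V -> q' \in V ->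
  f p' != f q' ->
  ~~ adj (contract f (exchange T p q p' q')) (f p) (f q) ->
  contract f (exchange T p q p' q') = exchange (contract f T) (f p) (f q) (f p') (f q').
Proof.
move=> tri pV' qV' fpq' nfpq; have TV := tri_sub tri.
have pq' : p' != q' by apply: contra fpq' => /eqP->.
have EV := exchange_sub p q TV pV' qV' pq'.
have CV := contract_sub_imfset f TV.
have CEV := exchange_sub (f p) (f q) CV (in_imfset _ f pV') (in_imfset _ f qV') fpq'.
apply: (adj_ext (contract_sub_imfset f EV) CEV) => u v.
rewrite adj_exchange; apply/idP/idP.
  move=> h; case/(adj_contractP _ _ _ EV): (h) => uv [x [y [xy fx fy]]].
  move: xy; rewrite adj_exchange => /orP[/orP[]/andP[/eqP ? /eqP ?]|/andP[_ xy]].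
  - by subst x y u v; rewrite !eqxx.
  - by subst x y u v; rewrite !eqxx !orbT.
  - apply/orP; right; apply/andP; split; last first.
      by apply/(adj_contractP _ _ _ TV); split=> //; exists x, y.
    apply: contra nfpq => /orP[]/andP[/eqP <- /eqP <-] //.
    by rewrite adj_sym.
case/orP=> [/orP[]/andP[/eqP-> /eqP->]|/andP[nuv]].
- by apply: adj_contract EV _ fpq'; rewrite adj_exchange !eqxx.
- by rewrite adj_sym; apply: adj_contract EV _ fpq'; rewrite adj_exchange !eqxx.
case/(adj_contractP _ _ _ TV)=> uv [x [y [xy fx fy]]].
apply/(adj_contractP _ _ _ EV); split=> //; exists x, y; split=> //.
rewrite adj_exchange xy andbT; apply/orP; right; apply: contra nuv.
by rewrite -fx -fy => /orP[]/andP[/eqP-> /eqP->]; rewrite !eqxx ?orbT.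
Qed.

(** The notion is stable under composition, and the maps below are assembled from monotone
    surjections, rotations and a reflection. *)
Definition flip_map (n m : nat) (f : nat -> nat) : Prop :=
  [/\ forall x, x < n -> f x < m,
      forall T, triangulation (polygon n) T -> triangulation (polygon m) (contract f T)
    & forall T T', flip_step (polygon n) T T' ->
        contract f T = contract f T' \/
        flip_step (polygon m) (contract f T) (contract f T')].

Lemma flip_map_ext n m f g : (forall x, x < n -> f x = g x) ->
  flip_map n m f -> flip_map n m g.
Proof.
move=> fg [fb ft fs].
have E T : triangulation (polygon n) T -> contract g T = contract f T.
  move=> tri; apply: (contract_ext (tri_sub tri)) => x.
  by rewrite in_polygon => /fg.
split=> [x xn|T tri|T T' st]; first by rewrite -fg ?fb.
  by rewrite E //; apply: ft.
by rewrite !E; [apply: fs|apply: flip_step_tri st|case/flip_stepP: st].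
Qed.

Lemma flip_map_comp n m p f g : flip_map n m g -> flip_map m p f ->
  flip_map n p (f \o g).
Proof.
move=> [gb gt gs] [fb ft fs]; split=> [x xn|T tri|T T' st]; first exact/fb/gb.
  by rewrite -(contract_comp f g (tri_sub tri)); apply/ft/gt.
have tri : triangulation (polygon n) T by case/flip_stepP: st.
have tri' := flip_step_tri st.
rewrite -(contract_comp f g (tri_sub tri)) -(contract_comp f g (tri_sub tri')).
by case: (gs _ _ st) => [->|/fs//]; left.
Qed.

(* The corners may be listed in any of the cyclic or reverse orders in which
   [f] puts them. *)
Lemma contract_flip n m f T T' a b c d a' b' c' d' :
  (forall T, triangulation (polygon n) T -> triangulation (polygon m) (contract f T)) ->
  triangulation (polygon n) T -> quad_flip T T' a b c d ->
  a' < b' < c' -> c' < d' ->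
  [\/ [/\ a' = f a, b' = f b, c' = f c & d' = f d],
      [/\ a' = f d, b' = f a, c' = f b & d' = f c]
    | [/\ a' = f d, b' = f c, c' = f b & d' = f a]] ->
  flip_step (polygon m) (contract f T) (contract f T').
Proof.
move=> ft tri qf abc' cd' perm.
have tri' := quad_flip_tri tri qf.
have TV := tri_sub tri; have triC := ft _ tri; have triC' := ft _ tri'.
have ncC := tri_planar triC'.
apply/flip_stepP; split=> //; exists a', b', c', d'.
have := quad_flip_vertices tri qf => /and4P[aV bV cV dV].
have /andP[/and5P[abc cd ab bc /andP[hcd ad]] diag] := qf.
have img x y : f x != f y -> adj T x y -> adj (contract f T) (f x) (f y).
  by move=> fxy xy; apply: adj_contract TV xy fxy.
have [fab [fbc [fcd [fad [fac fbd]]]]] : f a != f b /\ f b != f c /\ f c != f d /\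
    f a != f d /\ f a != f c /\ f b != f d.
  by case: perm => -[? ? ? ?]; subst a' b' c' d'; clear -abc' cd'; do !split; lia.
have hab := img _ _ fab ab; have hbc := img _ _ fbc bc.
have hcd' := img _ _ fcd hcd; have had := img _ _ fad ad.
(* The images of the two diagonals cross, so the triangulation [contract f T'] cannot contain both;
   this provides the absence required by [contract_exchange]. *)
have noboth : adj (contract f T') (f a) (f c) -> adj (contract f T') (f b) (f d) -> False.
  move=> hac hbd; case: perm => -[? ? ? ?]; subst a' b' c' d'.
  - exact: ncC hac hbd abc' cd'.
  - by rewrite adj_sym in hbd; apply: ncC hbd hac abc' cd'.
  - by rewrite adj_sym in hbd; rewrite adj_sym in hac; apply: ncC hbd hac abc' cd'.
apply/andP; split.
  by rewrite /quad abc' cd'; case: perm => -[-> -> -> ->];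
    rewrite ?hab ?hbc ?hcd' ?had //= ![adj _ (f d) _]adj_sym
    ?[adj _ (f c) (f b)]adj_sym ?[adj _ (f b) (f a)]adj_sym ?hab ?hbc ?hcd' ?had.
have symo T1 p q p' q' : exchange T1 p q p' q' = exchange T1 q p p' q'.
  by rewrite /exchange [X in _ `\ X]fsetUC.
have symn T1 p q p' q' : exchange T1 p q p' q' = exchange T1 p q q' p'.
  by rewrite /exchange [X in X |` _]fsetUC.
have [ac bd] : a != c /\ b != d by clear -abc cd; lia.
case/orP: diag => /andP[hd /eqP T'E].
  have hd' := img _ _ fac hd.
  have hn : adj (contract f T') (f b) (f d).
    rewrite T'E; apply: adj_contract (exchange_sub _ _ TV bV dV bd) _ fbd.
    by rewrite adj_exchange !eqxx.
  have nn : ~~ adj (contract f T') (f a) (f c) by apply/negP => /noboth; apply.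
  rewrite T'E in nn *; rewrite (contract_exchange tri bV dV fbd nn).
  case: perm => -[-> -> -> ->]; apply/orP.
  - by left; rewrite hd' eqxx.
  - by right; rewrite hd' symn eqxx.
  - by right; rewrite adj_sym hd' symo symn eqxx.
have hd' := img _ _ fbd hd.
have hn : adj (contract f T') (f a) (f c).
  rewrite T'E; apply: adj_contract (exchange_sub _ _ TV aV cV ac) _ fac.
  by rewrite adj_exchange !eqxx.
have nn : ~~ adj (contract f T') (f b) (f d) by apply/negP; apply: noboth.
rewrite T'E in nn *; rewrite (contract_exchange tri aV cV fac nn).
case: perm => -[-> -> -> ->]; apply/orP.
- by right; rewrite hd' eqxx.
- by left; rewrite adj_sym hd' symo eqxx.
- by left; rewrite adj_sym hd' symo symn eqxx.
Qed.

(** Crossing images come from crossing edges, because [k] is monotone. For maximality, an edge whose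
    image encloses the missing [uv] is shrunk as long as possible; the apex of its inner triangle
    then falls strictly between [u] and [v], and one of the two sides at this apex crosses [uv]. *)
Lemma flip_map_monotone n m k : 0 < n -> k 0 = 0 -> (k n.-1).+1 = m ->
  (forall x, x.+1 < n -> k x <= k x.+1 <= (k x).+1) -> flip_map n m k.
Proof.
move=> n0 k0 kn kS.
have mono x y : x <= y -> y < n -> k x <= k y.
  elim: y => [|y IH] xy yn; first by have -> : x = 0 by lia.
  have [?|xy'] := eqVneq x y.+1; first by subst x.
  by have := kS y yn; have := IH; lia.
have kb x : x < n -> k x < m by move=> xn; have := mono x n.-1; lia.
have refl x y : x < n -> y < n -> k x < k y -> x < y.
  by move=> xn yn kxy; have := mono y x; lia.
have kt T : triangulation (polygon n) T -> triangulation (polygon m) (contract k T).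
  move=> tri; have TV := tri_sub tri; have lt := tri_lt tri.
  apply/triangulationP; split.
  - by apply: contract_sub TV _ => x; rewrite !in_polygon; apply: kb.
  - move=> a b c d abc cd /(adj_contractP _ _ _ TV)[_ [x [z [xz fx fz]]]].
    apply/negP => /(adj_contractP _ _ _ TV)[_ [y [w [yw fy fw]]]].
    have /and3P[xn zn _] := lt _ _ xz; have /and3P[yn wn _] := lt _ _ yw.
    apply: (tri_planar tri xz yw).
      by apply/andP; split; apply: refl; lia.
    by apply: refl; lia.
  move=> u v; rewrite !in_polygon => um vm uv nuv.
  have : exists i j, [/\ i < j, k i <= u, v <= k j & adj T i j].
    exists 0, n.-1; split; rewrite ?(tri_root tri);
    by case: n n0 kn {kS mono kb refl tri lt TV nuv} => [|[|n']] //=; lia.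
  case=> i [j]; have [s] := ubnP (j - i); elim: s i j => // s IH i j ji [ij iu vj hij].
  have /and3P[in_ jn _] := lt _ _ hij.
  have [/andP[/eqP iu' /eqP jv']|nij] := boolP ((k i == u) && (k j == v)).
    by case/negP: nuv; rewrite -iu' -jv'; apply: adj_contract TV hij _; lia.
  have ij' : i.+1 < j.
    rewrite ltn_neqAle ij andbT; apply/eqP => e; have := kS i; rewrite e; lia.
  have [b [ibj hib hbj]] := apex_in tri ij' hij.
  have bn : b < n by lia.
  have [bu|ub] := leqP (k b) u; first by apply: (IH b j); [lia|split=> //; lia].
  have [vb|bv] := leqP v (k b); first by apply: (IH i b); [lia|split=> //; lia].
  have [iu'|iu'] := ltnP (k i) u.
    exists (k i), (k b); split; last by lia.
    by apply: adj_contract TV hib _; lia.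
  exists (k b), (k j); split; last by lia.
  by apply: adj_contract TV hbj _; lia.
split=> // T T' /flip_stepP[tri [a [b [c [d qf]]]]].
have := quad_flip_vertices tri qf; rewrite !in_polygon => /and4P[an bn cn dn].
have /andP[/and3P[abc cd _] _] := qf.
have [deg|nd] := boolP [|| k a == k b, k b == k c, k c == k d | k a == k d].
  by left; apply: contract_degenerate tri qf deg.
have [h1 [h2 h3]] : k a <= k b /\ k b <= k c /\ k c <= k d by do !split; apply: mono; lia.
right; apply: (contract_flip kt tri qf (a' := k a) (b' := k b) (c' := k c) (d' := k d)).
- by clear -nd h1 h2 h3; lia.
- by clear -nd h1 h2 h3; lia.
- by constructor 1.
Qed.

Definition mirror (n x : nat) : nat := n.-1 - x.

Lemma flip_map_mirror n : flip_map n n (mirror n).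
Proof.
have fb x : x < n -> mirror n x < n by rewrite /mirror; lia.
have ft T : triangulation (polygon n) T -> triangulation (polygon n) (contract (mirror n) T).
  move=> tri; have TV := tri_sub tri; have lt := tri_lt tri.
  have img x y : x < n -> y < n -> adj T (mirror n x) (mirror n y) ->
      adj (contract (mirror n) T) x y.
    move=> xn yn h; apply/(adj_contractP _ _ _ TV); have /and3P[_ _ ne] := lt _ _ h.
    split; first by apply: contra ne => /eqP->.
    by exists (mirror n x), (mirror n y); split=> //; rewrite /mirror; lia.
  apply/triangulationP; split.
  - by apply: contract_sub TV _ => x; rewrite !in_polygon; apply: fb.
  - move=> a b c d abc cd /(adj_contractP _ _ _ TV)[_ [x [z [xz fx fz]]]].
    apply/negP => /(adj_contractP _ _ _ TV)[_ [y [w [yw fy fw]]]].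
    have /and3P[xn zn _] := lt _ _ xz; have /and3P[yn wn _] := lt _ _ yw.
    rewrite adj_sym in xz; rewrite adj_sym in yw.
    by apply: (tri_planar tri yw xz); move: fx fy fz fw; rewrite /mirror; lia.
  move=> x y; rewrite !in_polygon => xn yn xy nxy.
  have [|||| u [v [uv h]]] := @tri_sat _ _ tri (mirror n y) (mirror n x).
  - by rewrite in_polygon fb.
  - by rewrite in_polygon fb.
  - by rewrite /mirror; lia.
  - by apply: contra nxy => h; apply: img; rewrite // adj_sym.
  have /and3P[un vn _] := lt _ _ uv.
  exists (mirror n v), (mirror n u); split; last by move: h; rewrite /mirror; lia.
  by apply: img; rewrite ?fb // adj_sym; move: uv; rewrite /mirror !subKn //; lia.
split=> // T T' /flip_stepP[tri [a [b [c [d qf]]]]]; right.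
have := quad_flip_vertices tri qf; rewrite !in_polygon => /and4P[an bn cn dn].
have /andP[/and3P[abc cd _] _] := qf.
apply: (contract_flip ft tri qf (a' := mirror n d) (b' := mirror n c)
  (c' := mirror n b) (d' := mirror n a)).
- by rewrite /mirror; lia.
- by rewrite /mirror; lia.
- by constructor 3.
Qed.

Definition turn (n x : nat) : nat := if x.+1 < n then x.+1 else 0.

Lemma flip_map_turn n : flip_map n n (turn n).
Proof.
pose back x := if x == 0 then n.-1 else x.-1.
have fb x : x < n -> turn n x < n by rewrite /turn; lia_if.
have fbk x : x < n -> back x < n by rewrite /back; lia_if.
have bK x : x < n -> turn n (back x) = x by rewrite /back /turn; lia_if.
have tK x : x < n -> back (turn n x) = x by rewrite /back /turn; lia_if.
have ft T : triangulation (polygon n) T -> triangulation (polygon n) (contract (turn n) T).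
  move=> tri; have TV := tri_sub tri; have lt := tri_lt tri.
  have img x y : x < n -> y < n -> adj T (back x) (back y) ->
      adj (contract (turn n) T) x y.
    move=> xn yn h; apply/(adj_contractP _ _ _ TV); have /and3P[_ _ ne] := lt _ _ h.
    split; first by apply: contra ne => /eqP->.
    by exists (back x), (back y); rewrite !bK.
  apply/triangulationP; split.
  - by apply: contract_sub TV _ => x; rewrite !in_polygon; apply: fb.
  - move=> a b c d abc cd /(adj_contractP _ _ _ TV)[_ [x [z [xz fx fz]]]].
    apply/negP => /(adj_contractP _ _ _ TV)[_ [y [w [yw fy fw]]]].
    have /and3P[xn zn _] := lt _ _ xz; have /and3P[yn wn _] := lt _ _ yw.
    (* Label 0 comes from the last vertex [n.-1], so for [a = 0] the preimages occur in the order
       [y], [z], [w], [x]. *)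
    have [a0|a0] := posnP a.
      rewrite adj_sym in xz; apply: (tri_planar tri yw xz);
      by move: fx fy fz fw; rewrite /turn; lia_if.
    by apply: (tri_planar tri xz yw); move: fx fy fz fw; rewrite /turn; lia_if.
  move=> x y; rewrite !in_polygon => xn yn xy nxy.
  have nbxy : ~~ adj T (back x) (back y) by apply: contra nxy; apply: img.
  have [x0|x0] := posnP x.
    have [|||| u [v [uv h]]] := @tri_sat _ _ tri (back y) (back x).
    - by rewrite in_polygon fbk.
    - by rewrite in_polygon fbk.
    - by rewrite /back; lia_if.
    - by rewrite adj_sym.
    have /and3P[un vn _] := lt _ _ uv.
    exists (turn n u), (turn n v); split; last by move: h; rewrite /back /turn; lia_if.
    by apply: img; rewrite ?fb ?tK.
  have [|||| u [v [uv h]]] := @tri_sat _ _ tri (back x) (back y).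
  - by rewrite in_polygon fbk.
  - by rewrite in_polygon fbk.
  - by rewrite /back; lia_if.
  - by [].
  have /and3P[un vn _] := lt _ _ uv.
  have im1 : adj (contract (turn n) T) (turn n u) (turn n v).
    by apply: img; rewrite ?fb ?tK.
  have [vn'|vn'] := ltnP v.+1 n.
    by exists (turn n u), (turn n v); split=> //; move: h; rewrite /back /turn; lia_if.
  exists (turn n v), (turn n u); split; first by rewrite adj_sym.
  by move: h; rewrite /back /turn; lia_if.
split=> // T T' /flip_stepP[tri [a [b [c [d qf]]]]]; right.
have := quad_flip_vertices tri qf; rewrite !in_polygon => /and4P[an bn cn dn].
have /andP[/and3P[abc cd _] _] := qf.
have [dn'|dn'] := ltnP d.+1 n.
  apply: (contract_flip ft tri qf (a' := turn n a) (b' := turn n b)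
    (c' := turn n c) (d' := turn n d)).
  - by rewrite /turn; lia_if.
  - by rewrite /turn; lia_if.
  - by constructor 1.
apply: (contract_flip ft tri qf (a' := turn n d) (b' := turn n a)
  (c' := turn n b) (d' := turn n c)).
- by rewrite /turn; lia_if.
- by rewrite /turn; lia_if.
- by constructor 2.
Qed.

(** * Flips lost under the contraction *)

Definition block_diagonals (T : edge_set) : nat :=
  adj T 0 2 + adj T 0 3 + adj T 1 3.

Definition hinge (T : edge_set) (x : nat) : bool :=
  has (fun u => has (fun v => [&& u < v, adj T u x & adj T v x]) (iota 0 4))
    (iota 0 4).

Definition hinges (T : edge_set) : nat := hinge T 6 + hinge T 7 + hinge T 8.

(** For sorted corners the fourth side [ad] cannot join consecutive labels, since [b] and [c] lie in
    between. *)
Definition side_of (x a b c d : nat) : bool :=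
  [|| (a == x) && (b == x.+1), (b == x) && (c == x.+1)
    | (c == x) && (d == x.+1)].

Lemma hingeP T x :
  reflect (exists u v, [/\ u < v < 4, adj T u x & adj T v x]) (hinge T x).
Proof.
apply: (iffP hasP) => [[u _ /hasP[v]]|[u [v [uv ux vx]]]].
  by rewrite mem_iota => v4 /and3P[uv ux vx]; exists u, v; split=> //; lia.
exists u; first by rewrite mem_iota; lia.
apply/hasP; exists v; first by rewrite mem_iota; lia.
by rewrite ux vx andbT; lia.
Qed.

Lemma hinges_le T T' x0 :
  (forall x, 5 < x < 9 -> x != x0 -> hinge T x -> hinge T' x) ->
  hinges T <= hinges T' + (5 < x0 < 9).
Proof.
move=> h; have := h 6 isT; have := h 7 isT; have := h 8 isT; rewrite /hinges.
by case: (hinge T 6); case: (hinge T 7); case: (hinge T 8); lia.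
Qed.

Section Flip.
Variables (n : nat) (T T' : edge_set) (a b c d : nat).
Hypotheses (tri : triangulation (polygon n) T) (qf : quad_flip T T' a b c d).

Lemma quad_flip_cases : exists p q p' q',
  [/\ T' = exchange T p q p' q', adj T p q
    & (p == a) && (q == c) && (p' == b) && (q' == d) ||
      (p == b) && (q == d) && (p' == a) && (q' == c)].
Proof.
case/andP: qf => _ /orP[]/andP[h /eqP->].
  by exists a, c, b, d; split; rewrite ?eqxx.
by exists b, d, a, c; split; rewrite ?eqxx ?orbT.
Qed.

(** A flip in a quadrilateral with two corners in the block 0, 1, 2, 3 or with the side {4, 5} pays,
    on balance, for at most one unit: a gain in [block_diagonals], a loss in [hinges], or a flip at
    {4, 5}. Any other flip has nothing to pay for. *)
Lemma flip_weight :
  block_diagonals T' + hinges T + side_of 4 a b c d <=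
  block_diagonals T + hinges T' + ((b < 4) || side_of 4 a b c d).
Proof.
have nc := tri_planar tri.
have /andP[/and5P[abc cd ab bc /andP[hcd ad]] _] := qf.
have [p [q [p' [q' [T'E pq choice]]]]] := quad_flip_cases.
have [pltq pltq'] : p < q /\ p' < q' by clear -abc cd choice; lia.
have keep x y : x < y -> adj T x y -> ~~ ((x == p) && (y == q)) -> adj T' x y.
  by move=> xy h ne; rewrite T'E adj_exchange h; clear -xy pltq ne; lia.
have grow x y : x < y -> adj T' x y -> ~~ ((x == p') && (y == q')) -> adj T x y.
  by move=> xy; rewrite T'E adj_exchange; clear -xy pltq'; case: adj; lia.
have keep_hinge x : 5 < x -> ~~ ((p < 4) && (q == x)) -> hinge T x -> hinge T' x.
  move=> x5 ne /hingeP[u [v [uv ux vx]]]; apply/hingeP; exists u, v; split=> //;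
  by apply: keep => //; clear -x5 ne uv; lia.
have Rq : hinges T <= hinges T' + (5 < q < 9).
  apply: hinges_le => x x59 xq; apply: keep_hinge; [clear -x59|clear -xq]; lia.
have Rkeep : (5 < q -> hinge T q -> hinge T' q) -> hinges T <= hinges T'.
  move=> hq; have := @hinges_le T T' 0; rewrite addn0; apply=> x x59 _ hx.
  have [xq|xq] := eqVneq x q.
    by move: hx x59; rewrite xq => hx /andP[x5 _]; apply: hq.
  by apply: keep_hinge hx; [clear -x59|clear -xq]; lia.
have Dgrow : ~~ (q' < 4) -> block_diagonals T' <= block_diagonals T.
  move=> nq; have := @grow 0 2 isT; have := @grow 0 3 isT; have := @grow 1 3 isT.
  rewrite /block_diagonals; clear -nq.
  by case: (adj T' 0 2); case: (adj T' 0 3); case: (adj T' 1 3); lia.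
have D1 : block_diagonals T' <= block_diagonals T + 1.
  have := @grow 0 2 isT; have := @grow 0 3 isT; have := @grow 1 3 isT.
  rewrite /block_diagonals; clear.
  by case: (adj T' 0 2); case: (adj T' 0 3); case: (adj T' 1 3); lia.
(* If {4, 5} is a side, each diagonal has exactly one of 4 and 5 as an end. So none lies in the
   block or joins it to 6, 7 or 8: [block_diagonals] does not grow and [hinges] does not fall. *)
have [s45|s45] := boolP (side_of 4 a b c d).
  rewrite orbT; move: s45; rewrite /side_of => s45.
  have : hinges T <= hinges T'.
    have := @hinges_le T T' 0; rewrite addn0; apply=> x x59 _; apply: keep_hinge;
    by clear -abc cd choice s45 x59; lia.
  have : block_diagonals T' <= block_diagonals T.
    by apply: Dgrow; clear -abc cd choice s45; lia.
  lia.
(* Now [a] and [b] lie in the block. If the new diagonal lies in it, then so does [c], and a hinge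
   at [d] survives as the apex over [a] and [c]; otherwise at most the hinge at [q] is lost. *)
rewrite orbF addn0; have [b4|b4] := ltnP b 4.
  have [q4|q4] := ltnP q' 4; last first.
    by apply: leq_trans (leq_add (Dgrow _) Rq) _; rewrite -?leqNgt //; lia.
  suff : hinges T <= hinges T' by move=> R0; have := leq_add D1 R0; lia.
  apply: Rkeep => q5 _; apply/hingeP; exists a, c.
  have -> : q = d by clear -choice q4 q5 abc cd; lia.
  by split; [clear -choice q4 q5 abc cd; lia | |];
     apply: keep => //; clear -choice q4 q5 abc cd; lia.
have R0 : hinges T <= hinges T'.
  apply: Rkeep => q5 hq; have [p4|p4] := ltnP p 4; last first.
    by apply: keep_hinge => //; clear -p4; lia.
  have [pa qc] : p = a /\ q = c by clear -choice p4 b4; lia.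
  (* With [b] outside the block, an edge to [c] from a vertex of the block other than [a] would
     cross [ad] or [ab]. So [c] is not a hinge and none is lost. *)
  have uniq_nbr w : w < 4 -> adj T w q -> w = a.
    rewrite qc => w4 wc; have [wa|aw|//] := ltngtP w a; exfalso.
      by apply: nc wc ad _ _; clear -wa abc cd; lia.
    by apply: nc ab wc _ _; clear -aw abc w4 b4; lia.
  case/hingeP: hq => u [v [/andP[uv v4] /uniq_nbr uq /uniq_nbr vq]].
  by have := uq (ltn_trans uv v4); have := vq v4; clear -uv; lia.
by apply: leq_trans (leq_add (Dgrow _) R0) _; clear -choice b4 abc cd; lia.
Qed.

(* [i] and [k] count the flips made so far in quadrilaterals with side {3, 4}
   and {4, 5} respectively, starting with the apex 5 over {3, 4}. *)
Definition around34 (i k : nat) (U : edge_set) : Prop :=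
  match i with
  | 0 => adj U 3 5
  | 1 => exists x, [/\ adj U 3 x, adj U 4 x
           & x = n.-1 -> (1 < k) || (0 < k) && adj U 5 n.-1]
  | _ => True
  end.

(** A single flip moves the apex over {3, 4} from 5 to [n.-1] only in the quadrilateral 3, 4, 5,
    [n.-1], which also has the side {4, 5} and leaves the edge from 5 to [n.-1]. While [n.-1] stays
    the apex over {3, 4}, that edge bounds a triangle on {4, 5}, and removing it takes another flip
    with this side. *)
Lemma flip_around34 i k : 11 < n -> around34 i k T ->
  around34 (i + side_of 3 a b c d) (k + side_of 4 a b c d) T'.
Proof.
move=> n11; have nc := tri_planar tri; have lt := tri_lt tri.
have /andP[/and5P[abc cd ab bc /andP[hcd ad]] _] := qf.
have [p [q [p' [q' [T'E pq choice]]]]] := quad_flip_cases.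
have [pltq pltq'] : p < q /\ p' < q' by clear -abc cd choice; lia.
have keep x y : adj T x y -> ~~ ((x == p) && (y == q) || (x == q) && (y == p)) ->
    adj T' x y.
  by move=> h ne; rewrite T'E adj_exchange h ne orbT.
have new : adj T' p' q' by rewrite T'E adj_exchange !eqxx.
case: i => [|[|i]] /=; last by [].
  move=> h35; case/orP: choice => /andP[/andP[/andP[/eqP ? /eqP ?] /eqP ?] /eqP ?];
  subst p q p' q'; rewrite /side_of.
  - have [s34|s34] := boolP ((a == 3) && (b == 4)).
      case/andP: s34 => /eqP ? /eqP ?; subst a b => /=.
      have c5 : c = 5.
        have [//|c5] := eqVneq c 5; case: (nc _ _ _ _ h35 bc); clear -abc c5; lia.
      exists d; split=> //; first by apply: keep => //; clear -cd; lia.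
      move=> dn; apply/orP; right; apply/andP; split; first by clear -c5; lia.
      by rewrite -c5 -dn; apply: keep => //; clear -abc cd; lia.
    have [s34'|s34'] := boolP ((b == 3) && (c == 4)).
      by case: (nc _ _ _ _ pq h35); clear -s34' abc; lia.
    have [s34''|s34''] := boolP ((c == 3) && (d == 4)).
      by case: (nc _ _ _ _ ad h35); clear -s34'' abc; lia.
    by apply: keep => //; clear -s34 s34' abc cd; lia.
  have [s34|s34] := boolP ((a == 3) && (b == 4)).
    by case: (nc _ _ _ _ h35 pq); clear -s34 abc cd; lia.
  have [s34'|s34'] := boolP ((b == 3) && (c == 4)).
    case/andP: s34' => /eqP ? /eqP ?; subst b c => /=.
    exists a; split; [|by rewrite adj_sym|by clear -abc n11; lia].
    by rewrite adj_sym; apply: keep => //; clear -abc cd; lia.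
  have [s34''|s34''] := boolP ((c == 3) && (d == 4)).
    by case: (nc _ _ _ _ ad h35); clear -s34'' abc; lia.
  by apply: keep => //; clear -s34 s34' abc cd; lia.
case=> x [h3x h4x hx].
have [s34|s34] := boolP (side_of 3 a b c d); first by [].
have hx3 : adj T x 3 by rewrite adj_sym.
have hx4 : adj T x 4 by rewrite adj_sym.
have /and3P[_ _ x3] := lt _ _ h3x; have /and3P[_ _ x4] := lt _ _ h4x.
rewrite /side_of in s34; exists x; split.
- apply: keep => //; apply/negP => e.
  have := nc _ _ _ _ ab h4x; have := nc _ _ _ _ hx4 hcd.
  have := nc _ _ _ _ bc h4x; have := nc _ _ _ _ ad hx4.
  clear -e choice s34 abc cd x3 x4.
  by case/orP: choice => /andP[/andP[/andP[/eqP ? /eqP ?] /eqP ?] /eqP ?]; subst p q p' q'; lia.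
- apply: keep => //; apply/negP => e.
  have := nc _ _ _ _ h3x ad; have := nc _ _ _ _ hx3 bc.
  have := nc _ _ _ _ ab h3x; have := nc _ _ _ _ hx3 hcd.
  clear -e choice s34 abc cd x3 x4.
  by case/orP: choice => /andP[/andP[/andP[/eqP ? /eqP ?] /eqP ?] /eqP ?]; subst p q p' q'; lia.
move=> xn; have /orP[k1|/andP[k0 h5]] := hx xn; first by apply/orP; left; clear -k1; lia.
have [s45|s45] := boolP (side_of 4 a b c d); first by apply/orP; left; clear -k0; lia.
apply/orP; right; rewrite addn0 k0 /=; apply: keep => //; apply/negP => e.
have /and3P[_ dn _] := lt _ _ hcd; rewrite xn in h4x.
have := nc _ _ _ _ ab h4x; rewrite /side_of in s45.
clear -e choice s45 abc cd dn n11.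
by case/orP: choice => /andP[/andP[/andP[/eqP ? /eqP ?] /eqP ?] /eqP ?]; subst p q p' q'; lia.
Qed.

(** The removed diagonal is an edge of the triangle on {3, 4}, so the apex of this triangle leaves
    the link. *)
Lemma flip_incident3 : 11 < n -> side_of 3 a b c d -> incident (polygon n) 3 T T'.
Proof.
move=> n11 s34; have lt := tri_lt tri.
have /andP[/and5P[abc cd ab bc /andP[hcd ad]] _] := qf.
have [p [q [p' [q' [T'E pq choice]]]]] := quad_flip_cases.
have [x [h3x h4x gone]] : exists x, [/\ adj T 3 x, adj T 4 x
    & ~~ (adj T' 3 x && adj T' 4 x)].
  have gone x y : (x == p) && (y == q) || (x == q) && (y == p) -> ~~ adj T' x y.
    move=> h; rewrite T'E adj_exchange h /= orbF; move: h.
    clear -choice abc cd.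
    by case/orP: choice => /andP[/andP[/andP[/eqP ? /eqP ?] /eqP ?] /eqP ?]; subst p q p' q'; lia.
  case/or3P: s34 => /andP[/eqP ? /eqP ?]; 
  case/orP: choice => /andP[/andP[/andP[/eqP ? /eqP ?] /eqP ?] /eqP ?]; subst.
  - exists c; split=> //; rewrite negb_and gone //; lia.
  - exists d; split=> //; rewrite negb_and (gone 4 d) ?orbT //; lia.
  - exists a; split; [by rewrite adj_sym|by rewrite adj_sym|].
    rewrite negb_and (gone 4 a) ?orbT //; lia.
  - exists d; split=> //; rewrite negb_and (gone 3 d) //; lia.
  - exists a; split; [by rewrite adj_sym|by rewrite adj_sym|].
    rewrite negb_and (gone 3 a) //; lia.
  - exists b; split; [by rewrite adj_sym|by rewrite adj_sym|].
    rewrite negb_and (gone 4 b) ?orbT //; lia.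
have -> : incident (polygon n) 3 T T' = (lk (polygon n) T 3 4 != lk (polygon n) T' 3 4).
  by rewrite /incident successor_polygon ?ifT //; clear -n11; lia.
apply/eqP => /fsetP/(_ x); rewrite !inE /= -!/(adj _ _ _) h3x h4x (negPf gone).
have /and3P[_ xn _] := lt _ _ h3x.
by rewrite mem_iota xn.
Qed.

End Flip.

(** This sums [flip_weight] along the path. By the hypothesis on [f] every flip that pays for a
    change of weight disappears; any further flip that disappears only shortens the image. *)
Lemma path_contract n m f T0 s : 11 < n -> flip_map n m f ->
  (forall a b c d, a < b < c -> c < d < n -> (b < 4) || side_of 4 a b c d ->
    [|| f a == f b, f b == f c, f c == f d | f a == f d]) ->
  triangulation (polygon n) T0 -> adj T0 3 5 ->
  path (flip_step (polygon n)) T0 s ->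
  exists s' i k,
  [/\ path (flip_step (polygon m)) (contract f T0) s'
      /\ last (contract f T0) s' = contract f (last T0 s),
      size s' + block_diagonals (last T0 s) + hinges T0 + k <=
        size s + block_diagonals T0 + hinges (last T0 s),
      i <= incident_flips (polygon n) 3 T0 s
    & around34 n i k (last T0 s)].
Proof.
move=> n11 [fb ft fs] fdeg tri0 h35.
elim/last_ind: s => [|s T' IH].
  by move=> _; exists [::], 0, 0; split=> //=; lia.
rewrite rcons_path last_rcons => /andP[/IH[s' [i [k [[ps' ls'] cost inc inv]]]] st].
have /flip_stepP[tri [a [b [c [d qf]]]]] := st.
have := quad_flip_vertices tri qf; rewrite !in_polygon => /and4P[an bn cn dn].
have /andP[/and3P[abc cd _] _] := qf.
have wt := flip_weight tri qf.
have incE : incident_flips (polygon n) 3 T0 (rcons s T') =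
    incident_flips (polygon n) 3 T0 s + incident (polygon n) 3 (last T0 s) T'.
  by rewrite /incident_flips -cats1 pairmap_cat sumn_cat /= addn0.
have inc' : i + side_of 3 a b c d <= incident_flips (polygon n) 3 T0 (rcons s T').
  rewrite incE leq_add //; case: (boolP (side_of 3 a b c d)) => // s34.
  by rewrite (flip_incident3 tri qf).
have inv' := flip_around34 tri qf n11 inv.
have [ctr|ctr] : contract f (last T0 s) = contract f T' \/
    (((b < 4) || side_of 4 a b c d) = false /\
     flip_step (polygon m) (contract f (last T0 s)) (contract f T')).
  case E: ((b < 4) || side_of 4 a b c d); last by case: (fs _ _ st); [left|right].
  by left; apply: contract_degenerate tri qf _; apply: fdeg; rewrite ?cd.
  exists s', (i + side_of 3 a b c d), (k + side_of 4 a b c d); split=> //.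
    by rewrite ls' ctr.
  by rewrite size_rcons; move: wt; case: (_ || _) => /=; clear -cost; lia.
exists (rcons s' (contract f T')), (i + side_of 3 a b c d), (k + side_of 4 a b c d).
split=> //; first by rewrite rcons_path ps' ls' ctr.2 last_rcons.
by rewrite !size_rcons; move: wt; rewrite ctr.1 /=; clear -cost; lia.
Qed.

(** * Zigzags and the pair A *)

(** The ends of a zigzag edge add up to 6 or 5 modulo [N], according to the parity of its index. Two
    labels below [N] have a sum below [2 * N], whence the four values. *)
Definition zigzag_sum (N x y : nat) : bool :=
  [|| x + y == 5, x + y == 6, x + y == N + 5 | x + y == N + 6].

Lemma zigzag_edge_even N k : 8 < N -> k.*2 < N - 3 -> zigzag_edge N k.*2 =
  [fset (if k <= 2 then 2 - k else N + 2 - k); 4 + k].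
Proof.
move=> N8 kN; rewrite /zigzag_edge odd_double doubleK.
rewrite (modn_small (_ : 4 + k < N)); last by lia.
case: leqP => k2; last by rewrite modn_small //; lia.
have -> : N + 2 - k = N + (2 - k) by lia.
by rewrite modnDl modn_small //; lia.
Qed.

Lemma zigzag_edge_odd N k : 8 < N -> k.*2.+1 < N - 3 -> zigzag_edge N k.*2.+1 =
  [fset (if k <= 1 then 1 - k else N + 1 - k); 4 + k].
Proof.
move=> N8 kN; rewrite /zigzag_edge /= odd_double uphalf_double /=.
rewrite (modn_small (_ : 4 + k < N)); last by lia.
case: leqP => k2; last by rewrite modn_small //; lia.
have -> : N + 1 - k = N + (1 - k) by lia.
by rewrite modnDl modn_small //; lia.
Qed.

Lemma zigzag_edgeP N x y : 8 < N -> x < y ->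
  reflect (exists2 i, i < N - 3 & [fset x; y] = zigzag_edge N i)
    [&& y < N, zigzag_sum N x y & y != x.+1].
Proof.
move=> N8 xy; rewrite /zigzag_sum.
apply: (iffP idP) => [h|[i iN /eqP]].
  have [xy6|xy6] := boolP ((x + y == 6) || (x + y == N + 6)).
    (* The sum 6 or [N + 6] belongs to {2 - k, 4 + k}. The smaller end [x] is 2 - k as long as this
       is not reduced modulo [N], and 4 + k afterwards. *)
    pose k := if x + y == 6 then 2 - x else x - 4.
    exists k.*2; first by rewrite /k; lia_if.
    by rewrite zigzag_edge_even; [apply/eqP; rewrite eq_fset2| |]; rewrite /k; lia_if.
  pose k := if x + y == 5 then 1 - x else x - 4.
  exists k.*2.+1; first by rewrite /k; lia_if.
  by rewrite zigzag_edge_odd; [apply/eqP; rewrite eq_fset2| |]; rewrite /k; lia_if.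
rewrite -(odd_double_half i) in iN *.
move: iN; case: (odd i); rewrite /= ?add1n ?add0n => iN.
  by rewrite zigzag_edge_odd // eq_fset2; lia_if.
by rewrite zigzag_edge_even // eq_fset2; lia_if.
Qed.

Lemma adj_zigzag N x y : 8 < N -> x < y -> adj (zigzag N) x y =
  (y < N) && [|| y == x.+1, (x == 0) && (y.+1 == N) | zigzag_sum N x y].
Proof.
move=> N8 xy; rewrite /zigzag {1}/adj in_fsetU -/(adj _ x y) adj_boundary //.
have -> : ([fset x; y] \in [fset zigzag_edge N i | i in iota 0 (N - 3)]) =
    [&& y < N, zigzag_sum N x y & y != x.+1].
  apply/imfsetP/(zigzag_edgeP N8 xy) => [[i /=]|[i iN e]].
    by rewrite mem_iota => iN e; exists i => //; lia.
  by exists i => //=; rewrite mem_iota; lia.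
by case: (y < N) (zigzag_sum N x y) (y == x.+1) => [] [] []; rewrite ?orbT ?orbF.
Qed.

Lemma zigzag_sub N : 8 < N -> zigzag N `<=` edges (polygon N).
Proof.
move=> N8; rewrite fsubUset; apply/andP; split; apply/fsubsetP => e /imfsetP[i /=].
  rewrite in_polygon => iN ->; rewrite -/(adj _ _ _) adj_edges.
  by rewrite successor_polygon // !in_polygon; lia_if.
rewrite mem_iota add0n -(odd_double_half i) => iN ->.
move: iN; case: (odd i); rewrite /= ?add1n ?add0n => iN.
  by rewrite zigzag_edge_odd // -/(adj _ _ _) adj_edges !in_polygon; lia_if.
by rewrite zigzag_edge_even // -/(adj _ _ _) adj_edges !in_polygon; lia_if.
Qed.

Lemma zigzag_tri N : 11 < N -> triangulation (polygon N) (zigzag N).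
Proof.
move=> N11; have N8 : 8 < N by lia.
apply/triangulationP; split; first exact: zigzag_sub.
  move=> a b c d abc cd; rewrite !adj_zigzag //; try lia.
  by rewrite /zigzag_sum; lia.
move=> x y _; rewrite in_polygon => yN xy; rewrite adj_zigzag // yN /= => nxy.
have wit u v : (x < u < y) && (y < v) || (u < x < v) && (v < y) -> v < N ->
    zigzag_sum N u v -> exists u v, adj (zigzag N) u v /\
      ((x < u < y) && (y < v) || (u < x < v) && (v < y)).
  move=> uvxy vN uv; exists u, v; split=> //; rewrite adj_zigzag // ?vN ?uv ?orbT //.
  by clear -uvxy xy; lia.
rewrite /zigzag_sum in nxy wit.
(* A pair of sum above [N + 6] is crossed by an edge of sum [N + 5], and a pair of sum below [N + 5]
   with [6 <= x] by one of sum [N + 6]. The remaining pairs, with an end close to 0, are crossed by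
   explicit edges. *)
have [s5|s5] := ltnP (x + y) 5.
  have [x0|x0] := posnP x; last by apply: (wit 2 4); lia.
  have [y4|y4] := ltnP y 4; first by apply: (wit 1 4); lia.
  by apply: (wit 1 5); lia.
have [sN|sN] := ltnP (N + 6) (x + y); first by apply: (wit (N + 6 - y) y.-1); lia.
have [x6|x6] := leqP 6 x; first by apply: (wit x.+1 (N + 5 - x)); lia.
case: x xy nxy s5 sN x6 wit => [|[|[|[|[|[|//]]]]]] xy nxy s5 sN _ wit.
- by apply: (wit 6 N.-1); lia.
- by apply: (wit 0 5); lia.
- by apply: (wit 1 4); lia.
- by apply: (wit 2 4); lia.
- by apply: (wit 0 5); lia.
- by apply: (wit 0 6); lia.
Qed.

(** * Deletions and relabellings as contractions *)

Lemma deletionE V T a b : T `<=` edges V -> b \in V -> a != b ->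
  successor V a = b ->
  deletion (V, T) a = (V `\ a, contract (fun x => if x == a then b else x) T).
Proof.
move=> TV bV ab sa; rewrite /deletion sa; congr pair.
(* Merging [a] into [b] collapses the edge {a, b} and no other, so discarding it beforehand agrees
   with the cardinality test of [contract]. *)
apply/fsetP => e; apply/imfsetP/idP => [[f /=]|].
  rewrite in_fsetD1 => /andP[fab fT] ->; rewrite !inE /=; apply/andP; split.
    by apply/imfsetP; exists f.
  have /edgesP[x [y [_ _ xy fE]]] := fsubsetP TV _ fT; subst f.
  rewrite imfset2 cardfs2 eqSS eqb1; move: fab; rewrite eq_fset2.
  by clear -xy ab; lia_if.
rewrite !inE /= => /andP[/imfsetP[f /= fT ->] c2].
exists f => //=; rewrite in_fsetD1 fT andbT; apply: contraTneq c2 => ->.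
by rewrite imfset2 eqxx if_same cardfs2 eqxx.
Qed.

Lemma deletion_sub V T a b : T `<=` edges V -> b \in V -> a != b ->
  contract (fun x => if x == a then b else x) T `<=` edges (V `\ a).
Proof.
move=> TV bV ab; apply: contract_sub TV _ => x xV; rewrite in_fsetD1.
by case: ifP => xa; rewrite ?xa ?xV // bV eq_sym ab.
Qed.

Lemma contract_id V T : T `<=` edges V -> contract id T = T.
Proof.
move=> TV; have CV : contract id T `<=` edges V by apply: contract_sub TV _.
apply: (adj_ext CV TV) => x y; apply/(adj_contractP _ _ _ TV)/idP.
  by case=> _ [u [v [uv <- <-]]].
move=> xy; split; last by exists x, y.
by have := fsubsetP TV _ xy; rewrite -/(adj _ x y) adj_edges => /and3P[].
Qed.

Lemma deletion_contract V0 Z V f a b : Z `<=` edges V0 ->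
  contract f Z `<=` edges V -> b \in V -> a != b -> successor V a = b ->
  deletion (V, contract f Z) a =
    (V `\ a, contract ((fun x => if x == a then b else x) \o f) Z) /\
  contract ((fun x => if x == a then b else x) \o f) Z `<=` edges (V `\ a).
Proof.
move=> ZV CV bV ab sa; rewrite (deletionE CV bV ab sa).
rewrite -(contract_comp (fun x => if x == a then b else x) f ZV).
by split=> //; apply: deletion_sub CV bV ab.
Qed.

Lemma relabelE V T a l g : T `<=` edges V -> {in V, new_label V a l =1 g} ->
  {in V &, injective g} -> relabel (V, T) a l = contract g T.
Proof.
move=> TV gE gi; apply/fsetP => e; rewrite !inE /=.
have imE f : f \in T -> [fset new_label V a l x | x in f] = [fset g x | x in f].
  move=> fT; have /edgesP[x [y [xV yV _ ->]]] := fsubsetP TV _ fT.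
  by rewrite !imfset2 !gE.
apply/imfsetP/andP => [[f /= fT ->]|[/imfsetP[f /= fT ->] _]].
  rewrite imE //; split; first by apply/imfsetP; exists f.
  have /edgesP[x [y [xV yV xy ->]]] := fsubsetP TV _ fT.
  by rewrite imfset2 cardfs2 eqSS eqb1; apply: contra xy => /eqP/gi->.
by exists f; rewrite ?imE.
Qed.

Lemma index_iota_sub m k x : m <= x < m + k -> index x (iota m k) = x - m.
Proof.
move=> h; rewrite -{1}(subnKC (_ : m <= x)); last by lia.
by rewrite -[m + _](nth_iota 0 m (n := k)) ?index_uniq ?size_iota ?iota_uniq //; lia.
Qed.

(** The composite of the steps defining [A_minus]: 0 and 1 are merged into 2, [h] and [h + 1] into
    [h + 2], and the labels count from 2 and wrap around at [n]. *)
Definition A_minus_map (n x : nat) : nat :=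
  let h := (n + 4)./2 in
  let y := if x <= 2 then 2 else if x <= h then x
           else if x <= h + 2 then h else x - 2 in
  if y < n then y else y - n.

(** Likewise for [A_plus]: 4 and 5 are merged into 6, [h + 4] and [h + 5] into the next vertex, and
    the labels count from 1 at the former vertex 2. *)
Definition A_plus_map (n x : nat) : nat :=
  let h := (n + 4)./2 in
  if x == 0 then n.-1 else if x == 1 then 0 else if x <= 3 then x.-1
  else if x <= 6 then 3 else if x <= h + 3 then x - 3
  else if x <= h + 6 then h + 1 else x - 5.

Lemma half_bounds N : (N./2).*2 <= N <= (N./2).*2.+1.
Proof. by rewrite -{2 4}(odd_double_half N); case: (odd N); lia. Qed.

Lemma A_minusE n : 7 < n -> A_minus n = contract (A_minus_map n) (zigzag (n + 4)).
Proof.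
move=> n7; rewrite /A_minus /A_minus_map /bar; have := half_bounds (n + 4).
set N := n + 4; set h := N./2 => hN.
have NE : N = n + 4 by []; clearbody N h.
have N8 : 8 < N by lia.
rewrite add0n add1n (modn_small (_ : h < N)) ?(modn_small (_ : h.+1 < N)); try lia.
have V0 := zigzag_sub N8.
have C0 : contract id (zigzag N) `<=` edges (polygon N) by rewrite (contract_id V0).
rewrite -{1}(contract_id V0) /foldl.
have [|||-> C1] := deletion_contract (a := 0) (b := 1) V0 C0.
- by rewrite in_polygon; lia.
- by [].
- by rewrite successor_polygon ?ifT //; lia.
have [|||-> C2] := deletion_contract (a := 1) (b := 2) V0 C1.
- by rewrite in_fsetD1 in_polygon; lia.
- by [].
- apply: successor_lt => [||//|c _]; rewrite ?in_fsetD1 ?in_polygon; lia.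
have [|||-> C3] := deletion_contract (a := h) (b := h.+1) V0 C2.
- by rewrite !in_fsetD1 in_polygon; lia.
- by lia.
- apply: successor_lt => [||//|c _]; rewrite ?in_fsetD1 ?in_polygon; lia.
have [|||-> C4] := deletion_contract (a := h.+1) (b := h.+2) V0 C3.
- by rewrite !in_fsetD1 in_polygon; lia.
- by lia.
- apply: successor_lt => [||//|c]; rewrite !in_fsetD1 ?in_polygon; lia.
pose g x := if x <= h then x else if x - 2 < n then x - 2 else x - 2 - n.
set V4 := _ `\ _ in C4 *.
have in4 x : (x \in V4) = [&& x < N, 1 < x, x != h & x != h.+1].
  by rewrite /V4 !in_fsetD1 in_polygon; lia.
have s4 : clockwise_seq V4 = iota 2 (h - 2) ++ iota (h + 2) (N - (h + 2)).
  apply: clockwise_seqE => [|x]; last by rewrite in4 mem_cat !mem_iota; lia.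
  rewrite (sorted_pairwise ltn_trans) pairwise_cat -!(sorted_pairwise ltn_trans).
  rewrite !iota_ltn_sorted !andbT; apply/allrelP => x y.
  by rewrite !mem_iota; lia.
rewrite (@relabelE _ _ _ _ g C4).
- rewrite (contract_comp _ _ V0); apply: (contract_ext V0) => x.
  rewrite in_polygon /g /= => xN; clear -xN hN NE n7.
  by lia_if.
- move=> x; rewrite in4 => xV; rewrite /new_label s4.
  have -> : index 2 (iota 2 (h - 2) ++ iota (h + 2) (N - (h + 2))) = 0.
    by rewrite index_cat mem_iota ifT ?index_iota_sub; lia.
  rewrite rot0 size_cat !size_iota index_cat mem_iota /g.
  have -> : h - 2 + (N - (h + 2)) = n by lia.
  case: ifP => hx; rewrite index_iota_sub; try lia.
    by rewrite modn_small ?ifT; lia.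
  rewrite ifF; last by lia.
  rewrite size_iota (_ : 2 + (_ + _) = x - 2); last by lia.
  case: ltnP => xn; first by rewrite modn_small.
  by rewrite -{1}(subnK xn) modnDr modn_small //; lia.
- move=> x y; rewrite !in4 /g => xV yV; clear -xV yV hN NE n7.
  by move=> e; apply/eqP; move: e; lia_if.
Qed.

Lemma A_plusE n : 7 < n -> A_plus n = contract (A_plus_map n) (zigzag (n + 4)).
Proof.
move=> n7; rewrite /A_plus /A_plus_map /bar; have := half_bounds (n + 4).
set N := n + 4; set h := N./2 => hN.
have NE : N = n + 4 by []; clearbody N h.
have N8 : 8 < N by lia.
rewrite (modn_small (_ : 4 + h < N)) ?(modn_small (_ : 5 + h < N)); try lia.
have V0 := zigzag_sub N8.
have C0 : contract id (zigzag N) `<=` edges (polygon N) by rewrite (contract_id V0).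
rewrite -{1}(contract_id V0) /foldl.
have [|||-> C1] := deletion_contract (a := 4) (b := 5) V0 C0.
- by rewrite in_polygon; lia.
- by [].
- by rewrite successor_polygon ?ifT //; lia.
have [|||-> C2] := deletion_contract (a := 5) (b := 6) V0 C1.
- by rewrite in_fsetD1 in_polygon; lia.
- by [].
- apply: successor_lt => [||//|c _]; rewrite ?in_fsetD1 ?in_polygon; lia.
have [|||-> C3] := deletion_contract (a := 4 + h) (b := 5 + h) V0 C2.
- by rewrite !in_fsetD1 in_polygon; lia.
- by lia.
- apply: successor_lt => [||//|c _]; rewrite ?in_fsetD1 ?in_polygon; lia.
(* For [N = 12] the vertex clockwise after [5 + h] is 0. *)
pose b4 := if 6 + h < N then 6 + h else 0.
have [|||-> C4] := deletion_contract (a := 5 + h) (b := b4) V0 C3.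
- by rewrite !in_fsetD1 in_polygon /b4; lia_if.
- by rewrite /b4; lia_if.
- rewrite /b4; case: ifP => hb.
    by apply: successor_lt => [||//|c]; rewrite !in_fsetD1 ?in_polygon; lia.
  by apply: successor_max => [||c]; rewrite !in_fsetD1 ?in_polygon; lia.
pose g x := if x == 0 then n.-1 else if x == 1 then 0 else if x <= 3 then x.-1
  else if x <= h + 3 then x - 3 else x - 5.
set V4 := _ `\ _ in C4 *.
have in4 x : (x \in V4) = [&& x < N, x != 4, x != 5, x != 4 + h & x != 5 + h].
  by rewrite /V4 !in_fsetD1 in_polygon; lia.
pose s2 := [:: 2; 3] ++ iota 6 (h - 2) ++ iota (h + 6) (N - (h + 6)).
have s4 : clockwise_seq V4 = [:: 0; 1] ++ s2.
  apply: clockwise_seqE => [|x]; last by rewrite in4 !mem_cat !inE !mem_iota; lia.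
  have big (y : nat) : y < 6 -> all (ltn y) (iota 6 (h - 2) ++ iota (h + 6) (N - (h + 6))).
    by move=> y6; apply/allP => z; rewrite mem_cat !mem_iota /=; lia.
  rewrite (sorted_pairwise ltn_trans) /= !big // pairwise_cat.
  rewrite -!(sorted_pairwise ltn_trans) !iota_ltn_sorted !andbT /=.
  by apply/allrelP => x y; rewrite !mem_iota; lia.
rewrite (@relabelE _ _ _ _ g C4).
- rewrite (contract_comp _ _ V0); apply: (contract_ext V0) => x.
  rewrite in_polygon /g /b4 /= => xN; clear -xN hN NE n7.
  by lia_if.
- move=> x; rewrite in4 => xV; rewrite /new_label s4.
  have -> : index 2 ([:: 0; 1] ++ s2) = 2 by [].
  have -> : size ([:: 0; 1] ++ s2) = n by rewrite !size_cat !size_iota /=; lia.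
  rewrite (rot_size_cat [:: 0; 1]).
  have -> : index x (s2 ++ [:: 0; 1]) = if x == 0 then n - 2 else
      if x == 1 then n.-1 else if x <= 3 then x - 2 else
      if x <= h + 3 then x - 4 else x - 6.
    rewrite !index_cat !mem_cat !inE !mem_iota !size_cat !size_iota /=.
    case: x xV => [|[|[|[|x]]]] xV /=; try by [].
    - by rewrite ifF; lia.
    - by rewrite ifF; lia.
    - rewrite ifT; last by lia.
      case: ifP => hx; rewrite index_iota_sub; try lia.
        by rewrite ifT; lia.
      by rewrite ifF; lia.
  rewrite /g; case: eqP => [_|x0]; first by rewrite modn_small; lia.
  case: eqP => [_|x1]; first by rewrite add1n prednK ?modnn //; lia.
  by clear -xV hN NE n7 x0 x1; rewrite modn_small; lia_if.
- move=> x y; rewrite !in4 /g => xV yV; clear -xV yV hN NE n7.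
  by move=> e; apply/eqP; move: e; lia_if.
Qed.

(** * Rotations, and the maps of the constructions as flip maps *)

Definition rotation (n k x : nat) : nat :=
  if x + k < n then x + k else x + k - n.

Lemma flip_map_rotation n k : 0 < n -> k < n -> flip_map n n (rotation n k).
Proof.
move=> n0; elim: k => [|k IH] kn.
  apply: (@flip_map_ext n n id) => [x xn|]; first by rewrite /rotation; lia_if.
  by apply: flip_map_monotone => //= [|x xn]; lia.
apply: (@flip_map_ext n n (turn n \o rotation n k)) => [x xn|].
  by rewrite /= /turn /rotation; lia_if.
by apply: flip_map_comp (flip_map_turn n); apply: IH; lia.
Qed.

Lemma flip_map_A_minus n : 7 < n -> flip_map (n + 4) n (A_minus_map n).
Proof.
move=> n7; rewrite /A_minus_map; have := half_bounds (n + 4).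
set h := (n + 4)./2 => hN; clearbody h.
pose k x := if x <= 2 then 0 else if x <= h then x - 2
            else if x <= h + 2 then h - 2 else x - 4.
apply: (@flip_map_ext _ _ (rotation n 2 \o k)) => [x xN|].
  by rewrite /= /rotation /k; lia_if.
apply: flip_map_comp; last by apply: flip_map_rotation; lia.
apply: flip_map_monotone => [||| x xN]; rewrite /k; by [|lia|lia_if].
Qed.

Lemma flip_map_A_plus n : 7 < n -> flip_map (n + 4) n (A_plus_map n).
Proof.
move=> n7; rewrite /A_plus_map; have := half_bounds (n + 4).
set h := (n + 4)./2 => hN; clearbody h.
pose k x := if x <= 2 then x else if x <= 4 then 2 else if x <= h + 2 then x - 2
            else if x <= h + 4 then h else x - 4.
(* The first rotation carries the vertex 2 to 0. Then neither merged block wraps around, and the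
   middle map is monotone. *)
apply: (@flip_map_ext _ _ (rotation n 1 \o (k \o rotation (n + 4) (n + 2)))) => [x xN|].
  by rewrite /= /rotation /k; lia_if.
apply: flip_map_comp; last by apply: flip_map_rotation; lia.
apply: flip_map_comp; first by apply: flip_map_rotation; lia.
apply: flip_map_monotone => [||| x xN]; rewrite /k; by [|lia|lia_if].
Qed.

(** The relabelling from the definition of [C_n], extended to the removed vertex 2 by sending it
    where 3 goes. *)
Definition unear_map (n x : nat) : nat :=
  if x <= 2 then x.+1 else if x < n then x else 0.

Lemma flip_map_unear n : 3 < n -> flip_map n.+1 n (unear_map n).
Proof.
move=> n3; pose k x := if x <= 2 then x else x.-1.
apply: (@flip_map_ext _ _ (rotation n 1 \o k)) => [x xN|].
  by rewrite /= /rotation /unear_map /k; lia_if.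
apply: flip_map_comp; last by apply: flip_map_rotation; lia.
apply: flip_map_monotone => [||| x xN]; rewrite /k; by [|lia|lia_if].
Qed.

(* The identification of 0, 1, 2, 3 and of 4, 5 followed by the reflection
   [x |-> 3 - x] modulo [n - 4]. *)
Definition fold_map (n x : nat) : nat :=
  if x <= 3 then 3 else if x <= 5 then 2 else if x <= 7 then 7 - x else n + 3 - x.

Lemma flip_map_fold n : 11 < n -> flip_map n (n - 4) (fold_map n).
Proof.
move=> n11; pose k x := if x <= 3 then 0 else if x <= 5 then 1 else x - 4.
(* [mirror] is [x |-> -1 - x] modulo [n - 4], so the rotation by 4 turns it into [x |-> 3 - x]. *)
apply: (@flip_map_ext _ _ (rotation (n - 4) 4 \o (mirror (n - 4) \o k))) => [x xN|].
  by rewrite /= /rotation /mirror /fold_map /k; lia_if.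
apply: flip_map_comp; last by apply: flip_map_rotation; lia.
apply: flip_map_comp (flip_map_mirror _).
apply: flip_map_monotone => [||| x xN]; rewrite /k; by [|lia|lia_if].
Qed.

(* The vertex 2 is an ear of [T], so removing it amounts to merging it with 3. *)
Lemma relabel_ear n T : 3 < n -> triangulation (polygon n.+1) T -> adj T 1 3 ->
  relabel (polygon n.+1 `\ 2, T `\` ear2) 3 3 = contract (unear_map n) T.
Proof.
move=> n3 tri h13; have TV := tri_sub tri; have nc := tri_planar tri.
have lt := tri_lt tri.
have adjE x y : adj (T `\` ear2) x y = [&& adj T x y,
    ~~ ((x == 1) && (y == 2) || (x == 2) && (y == 1)) &
    ~~ ((x == 2) && (y == 3) || (x == 3) && (y == 2))].
  by rewrite /adj in_fsetD in_fset2 !eq_fset2 negb_or andbC.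
have EV' : T `\` ear2 `<=` edges (polygon n.+1).
  exact: fsubset_trans (fsubsetDl _ _) TV.
have EV : T `\` ear2 `<=` edges (polygon n.+1 `\ 2).
  (* Any edge at 2 other than the two removed ones would cross {1, 3}. *)
  apply: (adj_subset EV') => x y xy; rewrite adjE adj_edges !in_fsetD1 !in_polygon.
  case/and3P=> hxy; have /and3P[-> -> ->] := lt _ _ hxy.
  rewrite !andbT; have := nc _ _ _ _ h13 hxy; have := nc _ _ _ _ hxy h13.
  by clear -xy n3; lia.
rewrite (relabelE EV (g := unear_map n)).
- have MV := contract_sub_imfset (unear_map n) TV.
  apply/eqP; rewrite eqEfsubset; apply/andP; split.
    apply: (adj_subset (contract_sub_imfset (unear_map n) EV)) => u v _.
    case/(adj_contractP _ _ _ EV)=> uv [x [y [xy fx fy]]].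
    apply/(adj_contractP _ _ _ TV); split=> //; exists x, y; split=> //.
    by move: xy; rewrite adjE => /andP[].
  apply: (adj_subset MV) => u v _ /(adj_contractP _ _ _ TV)[uv [x [y [xy fx fy]]]].
  apply/(adj_contractP _ _ _ EV); split=> //.
  have h31 : adj T 3 1 by rewrite adj_sym.
  (* The removed edge {1, 2} has the same image as {1, 3}, while {2, 3} collapses. *)
  have [/andP[/eqP ? /eqP ?]|n1] := boolP ((x == 1) && (y == 2)).
    by subst x y u v; exists 1, 3; rewrite adjE h13; split=> //; rewrite /unear_map /=; lia_if.
  have [/andP[/eqP ? /eqP ?]|n2] := boolP ((x == 2) && (y == 1)).
    by subst x y u v; exists 3, 1; rewrite adjE h31; split=> //; rewrite /unear_map /=; lia_if.
  exists x, y; split=> //; rewrite adjE xy (negPf n1) (negPf n2) /=.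
  apply/negP => h; case/negP: uv; rewrite -fx -fy /unear_map; clear -h n3; lia_if.
- have inV x : (x \in polygon n.+1 `\ 2) = (x != 2) && (x < n.+1).
    by rewrite in_fsetD1 in_polygon.
  move=> x; rewrite inV => xV; rewrite /new_label.
  have -> : clockwise_seq (polygon n.+1 `\ 2) = [:: 0; 1] ++ iota 3 (n - 2).
    apply: clockwise_seqE => [|y]; last by rewrite inV mem_cat !inE mem_iota; lia.
    have big (y : nat) : y < 3 -> all (ltn y) (iota 3 (n - 2)).
      by move=> y6; apply/allP => z; rewrite mem_iota /=; lia.
    rewrite (sorted_pairwise ltn_trans) /= !big // -(sorted_pairwise ltn_trans).
    exact: iota_ltn_sorted.
  have -> : index 3 ([:: 0; 1] ++ iota 3 (n - 2)) = 2.
    by rewrite index_cat /= index_iota_sub; lia.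
  have -> : size ([:: 0; 1] ++ iota 3 (n - 2)) = n by rewrite size_cat size_iota /=; lia.
  rewrite (rot_size_cat [:: 0; 1]) index_cat mem_iota size_iota /unear_map.
  case: ifP => hx.
    rewrite index_iota_sub; last by lia.
    have [xn|xn] := ltnP x n; first by rewrite modn_small ?ifF; lia.
    by rewrite (_ : 3 + (x - 3) = n) ?modnn ?ifF; lia.
  have [->|->] : x = 0 \/ x = 1 by lia.
    by rewrite /= (_ : 3 + _ = 1 + n) ?modnDr ?modn_small; lia.
  by rewrite /= (_ : 3 + _ = 2 + n) ?modnDr ?modn_small; lia.
- move=> x y; rewrite !in_fsetD1 !in_polygon /unear_map => xV yV e.
  by apply/eqP; move: e; clear -xV yV n3; lia_if.
Qed.

(** * The pair C *)

Definition cyc_adjacent (n x y : nat) : bool :=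
  [|| y == x.+1, x == y.+1, (x == 0) && (y.+1 == n) | (y == 0) && (x.+1 == n)].

Lemma tri_cyc n T x y : triangulation (polygon n) T -> x < n -> y < n -> x != y ->
  cyc_adjacent n x y -> adj T x y.
Proof.
move=> tri xn yn xy; have root := tri_root tri.
case/or4P=> [/eqP e|/eqP e|/andP[/eqP e /eqP e']|/andP[/eqP e /eqP e']].
- by rewrite e (tri_side tri) // -e.
- by rewrite adj_sym e (tri_side tri) // -e.
- by rewrite e (_ : y = n.-1) ?root; lia.
- by rewrite adj_sym e (_ : x = n.-1) ?root; lia.
Qed.

Lemma zigzag_adj_sum N x y : 8 < N -> x < N -> y < N -> x != y ->
  zigzag_sum N x y -> adj (zigzag N) x y.
Proof.
move=> N8 xN yN xy s; case: (ltngtP x y) xy => // xy _.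
  by rewrite adj_zigzag // yN s !orbT.
by rewrite adj_sym adj_zigzag // xN /zigzag_sum addnC -/(zigzag_sum N x y) s !orbT.
Qed.

Lemma zigzag_adj_cases N x y : 8 < N -> adj (zigzag N) x y ->
  [&& x < N, y < N, x != y & cyc_adjacent N x y || zigzag_sum N x y].
Proof.
move=> N8; have [xy|xy|<-] := ltngtP x y.
- by rewrite adj_zigzag // /cyc_adjacent => /andP[yN]; rewrite yN; lia.
- by rewrite adj_sym adj_zigzag // /cyc_adjacent /zigzag_sum => /andP[yN]; rewrite yN; lia.
- by move/(fsubsetP (zigzag_sub N8)); rewrite -/(adj _ x x) adj_edges eqxx !andbF.
Qed.

Lemma A_minus_tri n : 7 < n -> triangulation (polygon n) (A_minus n).
Proof.
move=> n7; rewrite A_minusE //; have [_ ft _] := flip_map_A_minus n7.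
by apply/ft/zigzag_tri; lia.
Qed.

Lemma A_plus_tri n : 7 < n -> triangulation (polygon n) (A_plus n).
Proof.
move=> n7; rewrite A_plusE //; have [_ ft _] := flip_map_A_plus n7.
by apply/ft/zigzag_tri; lia.
Qed.

Lemma adj_A_minus n x y u v : 7 < n -> A_minus_map n x = u -> A_minus_map n y = v ->
  u != v -> x < n + 4 -> y < n + 4 -> zigzag_sum (n + 4) x y -> adj (A_minus n) u v.
Proof.
move=> n7 xu yv uv xN yN s; rewrite A_minusE //.
apply/(adj_contractP _ _ _ (zigzag_sub (_ : 8 < n + 4))); first by lia.
split=> //; exists x, y; split=> //; apply: zigzag_adj_sum => //; first by lia.
by apply: contra uv => /eqP xy; rewrite -xu -yv xy.
Qed.

Lemma adj_A_plus n x y u v : 7 < n -> A_plus_map n x = u -> A_plus_map n y = v ->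
  u != v -> x < n + 4 -> y < n + 4 -> zigzag_sum (n + 4) x y -> adj (A_plus n) u v.
Proof.
move=> n7 xu yv uv xN yN s; rewrite A_plusE //.
apply/(adj_contractP _ _ _ (zigzag_sub (_ : 8 < n + 4))); first by lia.
split=> //; exists x, y; split=> //; apply: zigzag_adj_sum => //; first by lia.
by apply: contra uv => /eqP xy; rewrite -xu -yv xy.
Qed.

Local Ltac map_value := rewrite /unear_map /A_minus_map /A_plus_map;
  match goal with |- context [(?N)./2] =>
    have := half_bounds N; let h := fresh in set (h := N./2); clearbody h
  end; lia_if.

Local Ltac map_goal := first [done | lia | rewrite /zigzag_sum; lia | map_value].

(** The first three flips remove edges at 2 only, so an edge of [A_minus n.+1] avoiding 2 survives
    them. It survives the last flip too, since {4, 6} crosses the edge {2, 5} of [A_minus n.+1] and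
    hence does not belong to it. *)
Lemma C_minus_spec n : 11 < n ->
  [/\ triangulation (polygon n) (C_minus n), adj (C_minus n) 3 5,
      adj (C_minus n) 3 6
    & forall u v, adj (A_minus n.+1) u v -> u != 2 -> v != 2 ->
      unear_map n u != unear_map n v ->
      adj (C_minus n) (unear_map n u) (unear_map n v)].
Proof.
move=> n11; rewrite /C_minus /B_minus /=.
have n7 : 7 < n.+1 by lia.
have n3 : 3 < n by lia.
have small x : 2 < x < n -> unear_map n x = x by rewrite /unear_map; lia_if.
have [s3 s4 s6] : [/\ unear_map n 3 = 3, unear_map n 4 = 4 & unear_map n 6 = 6].
  by split; apply: small; lia.
pose T0 := A_minus n.+1; rewrite -/T0.
have tri0 : triangulation (polygon n.+1) T0 by apply: A_minus_tri.
(* The explicit labels are ends of edges of the larger zigzag: their sum is 5 or 6 modulo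
   [n.+1 + 4], and [A_minus_map] sends them to the required vertices. *)
have h24 : adj T0 2 4 by apply: (@adj_A_minus _ 2 4); map_goal.
have h25 : adj T0 2 5 by apply: (@adj_A_minus _ 0 5); map_goal.
have h26 : adj T0 2 6 by apply: (@adj_A_minus _ 0 6); map_goal.
have h16 : adj T0 1 6.
  by apply: (@adj_A_minus _ n.+4 6); map_goal.
have side x : x < n -> adj T0 x x.+1 by move=> xn; apply: (tri_side tri0); lia.
(* The three flips replace {2, 5} by {4, 6}, then {2, 4} by {3, 6}, then {2, 6} by {1, 3}; the last
   one makes 2 an ear. *)
have q0 : quad T0 2 4 5 6 by rewrite /quad h24 h26 !side //; clear -n11; lia.
have [e0 _] := flip_quad tri0 q0; rewrite (e0 h25).
set T1 := exchange _ _ _ _ _.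
have qf0 : quad_flip T0 T1 2 4 5 6 by rewrite /quad_flip q0 h25 eqxx.
have tri1 := quad_flip_tri tri0 qf0.
have q1 : quad T1 2 3 4 6 by rewrite /quad !adj_exchange /= h26 !side ?orbT //; clear -n11; lia.
have h24' : adj T1 2 4 by rewrite adj_exchange h24.
have [e1 _] := flip_quad tri1 q1; rewrite (e1 h24').
set T2 := exchange _ _ _ _ _.
have qf1 : quad_flip T1 T2 2 3 4 6 by rewrite /quad_flip q1 h24' eqxx.
have tri2 := quad_flip_tri tri1 qf1.
have q2 : quad T2 1 2 3 6 by rewrite /quad !adj_exchange /= h16 !side ?orbT //; clear -n11; lia.
have h26' : adj T2 2 6 by rewrite !adj_exchange h26.
have [_ e2] := flip_quad tri2 q2; rewrite (e2 h26').
set T3 := exchange _ _ _ _ _.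
have qf2 : quad_flip T2 T3 1 2 3 6 by rewrite /quad_flip q2 h26' eqxx orbT.
have tri3 := quad_flip_tri tri2 qf2.
have h13 : adj T3 1 3 by rewrite adj_exchange.
rewrite (relabel_ear n3 tri3 h13).
have [_ ft _] := flip_map_unear n3.
set B := contract _ T3; have triB : triangulation (polygon n) B by apply: ft.
have BV := tri_sub tri3.
have hB u v : adj T3 u v -> unear_map n u != unear_map n v ->
    adj B (unear_map n u) (unear_map n v) by apply: adj_contract BV.
have h46 : adj B 4 6.
  by have := hB 4 6; rewrite s4 s6; apply; rewrite // !adj_exchange.
have h36 : adj B 3 6.
  by have := hB 3 6; rewrite s3 s6; apply; rewrite // !adj_exchange.
have sideB x : x.+1 < n -> adj B x x.+1 by move=> xn; apply: (tri_side triB).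
have qB : quad B 3 4 5 6 by rewrite /quad h36 !sideB //; clear -n11; lia.
have [_ eB] := flip_quad triB qB; rewrite (eB h46).
have qfB : quad_flip B (exchange B 4 6 3 5) 3 4 5 6.
  by rewrite /quad_flip qB h46 eqxx orbT.
split.
- exact: quad_flip_tri triB qfB.
- by rewrite adj_exchange.
- by rewrite adj_exchange h36.
move=> u v uv u2 v2 ne.
have hbv : adj B (unear_map n u) (unear_map n v).
  by apply: hB => //; rewrite !adj_exchange uv; clear -u2 v2; lia.
rewrite adj_exchange hbv andbT; apply/orP; right; apply/negP.
have /and3P[un vn _] := tri_lt tri0 uv.
have nuv : ~ ((u == 4) && (v == 6) || (u == 6) && (v == 4)).
  case/orP=> /andP[/eqP ? /eqP ?]; subst u v; first exact: (tri_planar tri0 h25 uv).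
  by rewrite adj_sym in uv; apply: (tri_planar tri0 h25 uv).
by move: nuv; rewrite /unear_map; clear -un vn n11; lia_if.
Qed.

Lemma B_plusE n : 11 < n -> B_plus n = contract (unear_map n) (A_plus n.+1).
Proof.
move=> n11; rewrite /B_plus relabel_ear //; [lia|by apply: A_plus_tri; lia|].
by apply: (@adj_A_plus _ 2 4); map_goal.
Qed.

Lemma B_plus_tri n : 11 < n -> triangulation (polygon n) (B_plus n).
Proof.
move=> n11; rewrite B_plusE //; have n3 : 3 < n by lia.
by have [_ ft _] := flip_map_unear n3; apply/ft/A_plus_tri; lia.
Qed.

Lemma adj_B_plus n x y u v : 11 < n -> unear_map n (A_plus_map n.+1 x) = u ->
  unear_map n (A_plus_map n.+1 y) = v -> u != v -> x < n + 5 -> y < n + 5 ->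
  zigzag_sum (n.+1 + 4) x y -> adj (B_plus n) u v.
Proof.
move=> n11 xu yv uv xN yN s; rewrite B_plusE //.
have n7 : 7 < n.+1 by lia.
rewrite -xu -yv; apply: (adj_contract (tri_sub (A_plus_tri n7))); last by rewrite xu yv.
apply: (@adj_A_plus _ x y) => //; try by rewrite addSn -addnS.
by apply: contra uv => /eqP xy; rewrite -xu -yv xy.
Qed.

(** Both sides are triangulations, so one inclusion suffices. Sides of the polygon belong to each of
    them; any other edge of [A_plus m] comes from its zigzag and is lifted, by a map [w] that
    reflects the labels, to the zigzag behind [C_minus (m + 4)]. *)
Lemma contract_fold_C_minus m : 7 < m ->
  contract (fold_map (m + 4)) (C_minus (m + 4)) = A_plus m.
Proof.
move=> m7; have n11 : 11 < m + 4 by lia.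
have [triC _ _ hC] := C_minus_spec n11.
have [fb ft _] := flip_map_fold n11; rewrite addnK in fb ft.
have triF := ft _ triC; have triA := A_plus_tri m7.
apply/esym/(tri_max triA triF)/(adj_subset (tri_sub triA)) => u v _.
have N8 : 8 < m + 4 by lia.
rewrite A_plusE // => /(adj_contractP _ _ _ (zigzag_sub N8))[uv [x [y [xy fx fy]]]].
have /and4P[xN yN xny c] := zigzag_adj_cases N8 xy.
have [gb _ _] := flip_map_A_plus m7.
have [cy|ncy] := boolP (cyc_adjacent m u v).
  by apply: (tri_cyc triF) => //; rewrite -?fx -?fy gb.
have s : zigzag_sum (m + 4) x y.
  case/orP: c => // c; case/negP: ncy; move: c uv; rewrite -fx -fy /cyc_adjacent.
  by clear -m7 xN yN xny; map_value.
(* The only pair of sum 5 or 6 modulo [m + 4] that contains 3 is {2, 3}, whose image is a side. *)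
have s3 : (x != 3) && (y != 3).
  apply/negP => h; case/negP: ncy; move: s uv; rewrite -fx -fy /cyc_adjacent /zigzag_sum.
  by clear -m7 xN yN xny h; map_value.
(* Turns the sums 5 and 6 modulo [m + 4], which define the smaller zigzag, into
   the sums 6 and 5 modulo [m + 9]. *)
pose w z := if z <= 2 then 8 - z else m + 4 + 8 - z.
pose g z := A_minus_map (m + 4).+1 (w z).
have gE z : z < m + 4 -> z != 3 -> fold_map (m + 4) (unear_map (m + 4) (g z)) = A_plus_map m z.
  rewrite /g /w /fold_map /unear_map /A_minus_map /A_plus_map.
  have := half_bounds (m + 4); have := half_bounds ((m + 4).+1 + 4).
  set h1 := ((m + 4).+1 + 4)./2; set h2 := (m + 4)./2; clearbody h1 h2.
  by clear -m7 => h1b h2b zN z3; lia_if.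
have wb z : z < m + 4 -> z != 3 -> w z < (m + 4).+1 + 4.
  by rewrite /w; clear; lia_if.
have g2 z : z < m + 4 -> z != 3 -> g z != 2.
  by rewrite /g /w; clear -m7; map_value.
have sw : zigzag_sum ((m + 4).+1 + 4) (w x) (w y).
  by move: s s3; rewrite /zigzag_sum /w; clear -xN yN xny; lia_if.
case/andP: s3 => x3 y3.
have fne : fold_map (m + 4) (unear_map (m + 4) (g x)) !=
    fold_map (m + 4) (unear_map (m + 4) (g y)) by rewrite !gE // fx fy.
have une : unear_map (m + 4) (g x) != unear_map (m + 4) (g y).
  by apply: contra fne => /eqP->.
rewrite -fx -fy -!gE //; apply: (adj_contract (tri_sub triC)) => //.
apply: hC; rewrite ?g2 //; apply: (@adj_A_minus _ (w x) (w y)); rewrite ?wb //.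
  by clear -m7; lia.
by apply: contra une => /eqP->.
Qed.

Lemma contract_fold_B_plus m : 7 < m ->
  contract (fold_map (m + 4)) (B_plus (m + 4)) = A_minus m.
Proof.
move=> m7; have n11 : 11 < m + 4 by lia.
have triB := B_plus_tri n11.
have [fb ft _] := flip_map_fold n11; rewrite addnK in fb ft.
have triF := ft _ triB; have triA := A_minus_tri m7.
apply/esym/(tri_max triA triF)/(adj_subset (tri_sub triA)) => u v _.
have N8 : 8 < m + 4 by lia.
rewrite A_minusE // => /(adj_contractP _ _ _ (zigzag_sub N8))[uv [x [y [xy fx fy]]]].
have /and4P[xN yN xny c] := zigzag_adj_cases N8 xy.
have [gb _ _] := flip_map_A_minus m7.
have [cy|ncy] := boolP (cyc_adjacent m u v).
  by apply: (tri_cyc triF) => //; rewrite -?fx -?fy gb.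
have s : zigzag_sum (m + 4) x y.
  case/orP: c => // c; case/negP: ncy; move: c uv; rewrite -fx -fy /cyc_adjacent.
  by clear -m7 xN yN xny; map_value.
have s3 : (x != 3) && (y != 3).
  apply/negP => h; case/negP: ncy; move: s uv; rewrite -fx -fy /cyc_adjacent /zigzag_sum.
  by clear -m7 xN yN xny h; map_value.
(* As before, except that 2 is first replaced by 1, which has the same image
   under [A_minus_map m]. *)
pose w z := if z == 2 then 7 else if z <= 2 then 8 - z else m + 4 + 8 - z.
pose g z := unear_map (m + 4) (A_plus_map (m + 4).+1 (w z)).
have gE z : z < m + 4 -> z != 3 -> fold_map (m + 4) (g z) = A_minus_map m z.
  rewrite /g /w /fold_map /unear_map /A_minus_map /A_plus_map.
  have := half_bounds (m + 4); have := half_bounds ((m + 4).+1 + 4).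
  set h1 := ((m + 4).+1 + 4)./2; set h2 := (m + 4)./2; clearbody h1 h2.
  by clear -m7 => h1b h2b zN z3; lia_if.
have wb z : z < m + 4 -> z != 3 -> w z < m + 4 + 5.
  by rewrite /w; clear; lia_if.
have sw : zigzag_sum ((m + 4).+1 + 4) (w x) (w y).
  by move: s s3; rewrite /zigzag_sum /w; clear -xN yN xny; lia_if.
case/andP: s3 => x3 y3.
have fne : fold_map (m + 4) (g x) != fold_map (m + 4) (g y) by rewrite !gE // fx fy.
rewrite -fx -fy -!gE //; apply: (adj_contract (tri_sub triB)) => //.
apply: (@adj_B_plus _ (w x) (w y)); rewrite ?wb //.
by apply: contra fne => /eqP->.
Qed.

Lemma adj_C_minus n x y u v : 11 < n -> unear_map n (A_minus_map n.+1 x) = u ->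
  unear_map n (A_minus_map n.+1 y) = v -> u != v ->
  A_minus_map n.+1 x != 2 -> A_minus_map n.+1 y != 2 -> x < n + 5 -> y < n + 5 ->
  zigzag_sum (n.+1 + 4) x y -> adj (C_minus n) u v.
Proof.
move=> n11 xu yv uv x2 y2 xN yN s; have [_ _ _ hC] := C_minus_spec n11.
rewrite -xu -yv; apply: hC; rewrite ?xu ?yv //.
have n7 : 7 < n.+1 by lia.
apply: (@adj_A_minus _ x y) => //; try by rewrite addSn -addnS.
by apply: contra uv => /eqP xy; rewrite -xu -yv xy.
Qed.

(** The edge {1, 7} crosses {0, 2}, and {2, 6} crosses {0, 3} and {1, 3}. The hinges 6, 7, 8 are the
    apices over {2, 3}, {1, 2} and {0, 1}. *)
Lemma C_minus_weight n : 11 < n ->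
  block_diagonals (C_minus n) = 0 /\ hinges (C_minus n) = 3.
Proof.
move=> n11; have [triC _ h36 _] := C_minus_spec n11; have nc := tri_planar triC.
have h26 : adj (C_minus n) 2 6 by apply: (@adj_C_minus _ n.+4 6); map_goal.
have h27 : adj (C_minus n) 2 7 by apply: (@adj_C_minus _ n.+4 7); map_goal.
have h17 : adj (C_minus n) 1 7 by apply: (@adj_C_minus _ n.+3 7); map_goal.
have h18 : adj (C_minus n) 1 8 by apply: (@adj_C_minus _ n.+3 8); map_goal.
have h08 : adj (C_minus n) 0 8 by apply: (@adj_C_minus _ n.+2 8); map_goal.
split.
  have /negPf h02 : ~~ adj (C_minus n) 0 2 by apply/negP => h; apply: nc h h17 _ _.
  have /negPf h03 : ~~ adj (C_minus n) 0 3 by apply/negP => h; apply: nc h h26 _ _.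
  have /negPf h13 : ~~ adj (C_minus n) 1 3 by apply/negP => h; apply: nc h h26 _ _.
  by rewrite /block_diagonals h02 h03 h13.
have H6 : hinge (C_minus n) 6 by apply/hingeP; exists 2, 3.
have H7 : hinge (C_minus n) 7 by apply/hingeP; exists 1, 2.
have H8 : hinge (C_minus n) 8 by apply/hingeP; exists 0, 1.
by rewrite /hinges H6 H7 H8.
Qed.

(** A hinge at 6, 7 or 8 would be joined to a vertex of the block below 3, by an edge crossing the
    one from 3 to [n.-1]. *)
Lemma B_plus_weight n : 11 < n ->
  1 < block_diagonals (B_plus n) /\ hinges (B_plus n) = 0.
Proof.
move=> n11; have nc := tri_planar (B_plus_tri n11).
have h03 : adj (B_plus n) 0 3 by apply: (@adj_B_plus _ 0 5); map_goal.
have h13 : adj (B_plus n) 1 3 by apply: (@adj_B_plus _ 1 5); map_goal.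
have h3p : adj (B_plus n) 3 n.-1 by apply: (@adj_B_plus _ 6 n.+4); map_goal.
split; first by rewrite /block_diagonals h03 h13; case: adj.
have none x : 5 < x < 9 -> hinge (B_plus n) x = false.
  move=> x59; apply/negP => /hingeP[u [v [uv ux _]]].
  by apply: nc ux h3p _ _; clear -x59 uv n11; lia.
by rewrite /hinges !none.
Qed.

(** In [B_plus n] the apex over {3, 4} is [n.-1], and the edge from 4 to [n - 2] rules out the one
    from 5 to [n.-1]. So only the alternative with two flips at {4, 5} is left. *)
Lemma around34_B_plus n i k : 11 < n -> i <= 1 -> around34 n i k (B_plus n) -> 1 < k.
Proof.
move=> n11 i1; have nc := tri_planar (B_plus_tri n11).
have h3p : adj (B_plus n) 3 n.-1 by apply: (@adj_B_plus _ 6 n.+4); map_goal.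
have h4p : adj (B_plus n) 4 n.-1 by apply: (@adj_B_plus _ 7 n.+4); map_goal.
have h4q : adj (B_plus n) 4 (n - 2) by apply: (@adj_B_plus _ 7 n.+3); map_goal.
case: i i1 => [|[|//]] _ /=.
  by move=> h35; case: (nc _ _ _ _ h35 h4p); clear -n11; lia.
case=> x [h3x h4x]; have lt := tri_lt (B_plus_tri n11).
have /and3P[_ xn x3] := lt _ _ h3x; have /and3P[_ _ x4] := lt _ _ h4x.
have -> : x = n.-1.
  have hx4 : adj (B_plus n) x 4 by rewrite adj_sym.
  have := nc _ _ _ _ h3x h4p; have := nc _ _ _ _ hx4 h3p.
  by clear -n11 xn x3 x4; lia.
case/(_ erefl)/orP => // /andP[_ h5p].
by case: (nc _ _ _ _ h4q h5p); clear -n11; lia.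
Qed.

Theorem theorem10 (n : nat) (hn : 11 < n)
    (h : vartheta (polygon n) (pair_C n) 3 <= 1) :
  delta (polygon (n - 4)) (pair_A (n - 4)) + 7 <= delta (polygon n) (pair_C n).
Proof.
have [triC h35 _ _] := C_minus_spec hn; have triB := B_plus_tri hn.
have n2 : 2 < n by lia.
have [s0 ps0] := flip_connected n2 triC triB.
have [s gs] := delta_geodesic ps0.
have inc1 := leq_trans (incident_flips_vartheta 3 gs) h.
case: gs => /andP[/= ps /eqP ls] <-.
(* If [b < 4], the corners [a] and [b] are identified; if {4, 5} is a side, then its ends are. *)
have deg a b c d : a < b < c -> c < d < n -> (b < 4) || side_of 4 a b c d ->
    [|| fold_map n a == fold_map n b, fold_map n b == fold_map n c,
        fold_map n c == fold_map n d | fold_map n a == fold_map n d].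
  by rewrite /side_of /fold_map; clear; lia_if.
have [s' [i [k [[ps' ls'] cost inc inv]]]] :=
  path_contract hn (flip_map_fold hn) deg triC h35 ps.
rewrite ls in ls' cost inv.
have m7 : 7 < n - 4 by lia.
have nE : n = n - 4 + 4 by lia.
have := contract_fold_C_minus m7; have := contract_fold_B_plus m7.
rewrite -nE => EB EC; rewrite EB EC in ps' ls'.
(* The folded path leads from [A_plus] to [A_minus], against the orientation of [pair_A], so it is
   reversed. *)
have [r [pr lr sr]] := path_rev ps'; rewrite ls' in pr lr.
have le : delta (polygon (n - 4)) (pair_A (n - 4)) <= size s'.
  by rewrite -sr; apply: delta_min; rewrite /flip_path /= pr lr eqxx.
have [D0 R0] := C_minus_weight hn; have [D1 R1] := B_plus_weight hn.
have k1 := around34_B_plus hn (leq_trans inc inc1) inv.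
(* The seven lost flips: two for the block diagonals, three for the hinges and two at {4, 5}. *)
by move: cost; rewrite D0 R0 R1; clear -k1 D1 le; lia.
Qed.
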